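(* Let $\mathbb{P}$ be the set of $m\times m$ positive definite (real symmetric or complex Hermitian) matrices, let $n\geq 2$, and let $\mathbf{w}=(w_1,\ldots,w_n)$ be a weight. Then the weighted least squares mean on $\mathbb{P}$ is monotonic for the Loewner order: if $A_1,\ldots,A_n,B_1,\ldots,B_n\in\mathbb{P}$ satisfy $B_i\leq A_i$ for all $1\leq i\leq n$, then $$\mathfrak{G}_n(\mathbf{w};B_1,\ldots,B_n)\leq \mathfrak{G}_n(\mathbf{w};A_1,\ldots,A_n).$$
   Context: The Loewner order: $A\leq B$ iff $B-A$ is positive semidefinite. The trace metric on $\mathbb{P}$ is $\delta(A,B)=\left(\sum_{i=1}^{m}\log^2\lambda_i(A^{-1}B)\right)^{1/2}$, where $\lambda_1(X),\ldots,\lambda_m(X)$ are the eigenvalues of $X$ counted with multiplicity. A weight is a tuple $\mathbf{w}=(w_1,\ldots,w_n)$ of positive real numbers with $\sum_{i=1}^n w_i=1$. The weighted least squares mean of $(A_1,\ldots,A_n)\in\mathbb{P}^n$ is $\mathfrak{G}_n(\mathbf{w};A_1,\ldots,A_n)=\arg\min_{X\in\mathbb{P}}\sum_{i=1}^n w_i\delta^2(X,A_i)$; the minimizer exists and is unique (known fact). *)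

(* Defs.v *)
From mathcomp Require Import all_boot all_order all_algebra.
From mathcomp Require Import complex.
From mathcomp Require Import boolp classical_sets reals exp.

Set Implicit Arguments.
Unset Strict Implicit.
Unset Printing Implicit Defensive.

Import Order.TTheory GRing.Theory Num.Theory.

Local Open Scope ring_scope.
Local Open Scope complex_scope.
Local Open Scope sesquilinear_scope.
Local Open Scope classical_set_scope.

(* The scalar field K carries a conjugation theta: real symmetric matrices are
   the case K = R, theta = idfun, and complex Hermitian matrices the case
   K = R[i], theta = conjC. *)
Section Loewner.
Variables (K : numFieldType) (theta : K -> K) (m : nat).
Implicit Types A B : 'M[K]_m.

Definition posdefmx A : Prop :=
  A \is hermitianmx m false theta /\
  forall x : 'cV[K]_m, x != 0 -> 0 < (x ^t theta *m A *m x) 0 0.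

Definition possemidefmx A : Prop :=
  A \is hermitianmx m false theta /\
  forall x : 'cV[K]_m, 0 <= (x ^t theta *m A *m x) 0 0.

Definition loewner_le A B : Prop := possemidefmx (B - A).

End Loewner.

(* The monic characteristic polynomial splits over R[i]; this is the sequence
   of its roots, repeated according to multiplicity. *)
Definition eigenvalues (R : realType) (m : nat) (X : 'M[R[i]]_m) : seq R[i] :=
  sval (closed_field_poly_normal (char_poly X)).

Section LeastSquaresMean.
(* iota embeds the scalars into R[i], where eigenvalues are taken. *)
Variables (R : realType) (K : numFieldType) (theta : K -> K) (iota : K -> R[i]).
Variable m : nat.

(* For A and B positive definite the eigenvalues of A^-1 B are positive reals,
   so Re discards nothing. *)
Definition trace_metric (A B : 'M[K]_m) : R :=
  Num.sqrt (\sum_(l <- eigenvalues (map_mx iota (invmx A *m B)))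
    ln (complex.Re l) ^+ 2).

Definition least_squares n (w : 'I_n -> R) (A : 'I_n -> 'M[K]_m) (X : 'M[K]_m)
    : R :=
  \sum_i w i * trace_metric X (A i) ^+ 2.

(* The minimizer exists and is unique when w is a weight and every A i is
   positive definite; the identity matrix is the default value otherwise. *)
Definition least_squares_mean n (w : 'I_n -> R) (A : 'I_n -> 'M[K]_m)
    : 'M[K]_m :=
  xget 1%:M [set X | posdefmx theta X /\
    forall Y, posdefmx theta Y -> least_squares w A X <= least_squares w A Y].

End LeastSquaresMean.

Definition is_weight (R : realType) n (w : 'I_n -> R) : Prop :=
  (forall i, 0 < w i) /\ \sum_i w i = 1.

(* Main.v *)
Require Import Defs.
From mathcomp Require Import all_boot all_order all_algebra.
From mathcomp Require Import ring lra complex.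
From mathcomp Require Import boolp classical_sets reals exp.
From mathcomp Require functions topology normedtype sequences derive realfun.

Set Implicit Arguments.
Unset Strict Implicit.
Unset Printing Implicit Defensive.

Import Order.TTheory GRing.Theory Num.Theory.
Local Open Scope ring_scope.
Local Open Scope complex_scope.
Local Open Scope sesquilinear_scope.

(** Everything is done for complex Hermitian matrices; [X^t*] is the adjoint.
    Two positive definite matrices [A] and [X] are always handled through one
    factorization [A = S^* S], [X = S^* D S] with [S] invertible and [D] a
    positive diagonal matrix.  The entries [d_j] of [D] are the eigenvalues of
    [A^-1 X], so the squared distance is [sum_j (ln d_j)^2].

    First-order condition.  Let [X] minimize [sum_i w_i delta(X, A_i)^2] and
    write [X = S_i^* S_i], [A_i = S_i^* D_i S_i].  Perturbing [X] in the
    direction [(X v)(X v)^*] gives, for every vector [v],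
      [sum_i w_i sum_j |(S_i v)_j|^2 ln d_ij = 0]   ([minimizer_stationary]).
    The inner sum is the quadratic form at [v] of the relative entropy
    [X^(1/2) log(X^(-1/2) A_i X^(-1/2)) X^(1/2)], and the equation is the
    Karcher equation.  The derivative is never computed: an inequality of
    Klein type ([klein_bound]) bounds the change of a trace function by its
    linear part plus a quadratic error, which is enough at a minimum.

    Comparison of entropies.  If [B <= A], [Y <= Z] and [Y v = Z v], then the
    entropy form of [(Y, B)] at [v] is at most the one of [(Z, A)]
    ([entropy_mono]).  Indeed [u^* (B + l Y)^-1 u >= u^* (A + l Z)^-1 u] for
    [u = Y v = Z v] and [l >= 0], since inversion reverses the order; and
    logarithms are integrals of such resolvents over [l] ([ln_average_le]).

    Monotonicity.  Let [X] and [Y] be minimizers for [A] and [B] with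
    [B_i <= A_i], and let [s] be the least real number with [Y <= s X].  If
    [s > 1], pick [v] with [Y v = s X v] and [v^* X v = 1].  The entropy forms
    of the pairs [(Y, B_i)] at [v] have weighted sum [0], those of the pairs
    [(s X, A_i)] have weighted sum [- s ln s < 0], and the former is at most
    the latter by the comparison above: a contradiction.  So [s <= 1] and
    [Y <= X] ([minimizer_mono]).  In particular the minimizer is unique.

    Existence of the minimizer ([minimizer_exists]) is a compactness argument:
    a sublevel set lies in an order interval, on which the squared distances
    are uniformly continuous, again by the inequality of Klein type.

    Real symmetric matrices.  When the data are real, complex conjugation maps
    complex minimizers to complex minimizers; by uniqueness the complex
    minimizer is real, hence it is also the minimizer among real matrices, and
    the complex result applies. *)

(** * Real analysis *)

Section Analysis.
Import functions topology normedtype sequences derive realfun.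
Import numFieldNormedType.Exports.
Local Open Scope classical_set_scope.
Variable R : realType.

Lemma is_derive_ln_shift (a x : R) : 0 < a + x ->
  is_derive x 1 (fun y => ln (a + y)) (a + x)^-1.
Proof.
move=> h; rewrite -[(a+x)^-1]mul1r.
have := @is_derive1_comp R (@ln R) (fun y => a + y) x _ _ (is_derive1_ln h).
by rewrite mulrC; apply; rewrite -[X in is_derive _ _ _ X]add0r; apply: is_deriveD.
Qed.

(** The integral representation of the logarithm,
    [ln d = int_0^oo ((1 + x)^-1 - (d + x)^-1) dx], without the integral: the
    function [h] below has a nonpositive derivative by the hypothesis on the
    resolvents, and it tends to [0] at infinity because [p] and [q] have the
    same total mass; hence [h 0 >= 0]. *)
Lemma ln_average_le m (p q d e : 'I_m -> R) :
    (forall j, 0 <= p j) -> (forall j, 0 <= q j) ->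
    (forall j, 0 < d j) -> (forall j, 0 < e j) ->
    \sum_j p j = \sum_j q j ->
    (forall x, 0 <= x -> \sum_j q j / (e j + x) <= \sum_j p j / (d j + x)) ->
  \sum_j p j * ln (d j) <= \sum_j q j * ln (e j).
Proof.
move=> p0 q0 d0 e0 pq le_res.
pose h x := \sum_j (q j * ln (e j + x) - p j * ln (d j + x)).
pose h' x := \sum_j (q j * (e j + x)^-1 - p j * (d j + x)^-1).
have dh (x : R) : 0 <= x -> is_derive x 1 h (h' x).
  move=> x0; rewrite (_ : h = \sum_j (fun x => q j * ln (e j + x) - p j * ln (d j + x))).
    apply: is_derive_sum => j.
    apply: is_deriveB.
      by apply: is_deriveZ; apply: is_derive_ln_shift; rewrite ltr_wpDr.
    by apply: is_deriveZ; apply: is_derive_ln_shift; rewrite ltr_wpDr.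
  by apply/funext => y; rewrite fct_sumE.
have h_anti x : 0 <= x -> h x <= h 0.
  move=> x0; have [||c] := @MVT_segment R h h' 0 x x0.
  - by move=> y; rewrite in_itv /= => /andP[/ltW + _]; exact: dh.
  - apply: derivable_within_continuous => y; rewrite in_itv /= => /andP[y0 _].
    by case: (dh y y0).
  rewrite in_itv /= => /andP[c0 _] E; rewrite -subr_le0 E subr0.
  apply: mulr_le0_ge0 => //; rewrite /h' big_split /= sumrN subr_le0.
  exact: le_res.
pose D := \sum_j p j * d j.
(* From ln (d + x) <= ln x + d / x; the terms in ln x cancel. *)
have h_ge x : 0 < x -> - (D / x) <= h x.
  move=> x0; have -> : h x = h x - ln x * (\sum_j q j - \sum_j p j).
    by rewrite pq subrr mulr0 subr0.
  rewrite mulrBr !mulr_sumr opprB addrC -!sumrB /h -big_split /=.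
  rewrite /D mulr_suml -sumrN; apply: ler_sum => j _.
  have x_ne : x != 0 by rewrite gt_eqF.
  have le1 : ln x <= ln (e j + x) by rewrite ler_ln ?posrE ?addr_gt0 // lerDr ltW.
  have le2 : ln (d j + x) <= ln x + d j / x.
    have -> : d j + x = x * (1 + d j / x) by rewrite mulrDr mulr1 [x * _]mulrC divfK // addrC.
    have dx : 0 < d j / x by rewrite divr_gt0.
    rewrite lnM ?posrE ?addr_gt0 //.
    by rewrite lerD2l le_ln1Dx // (lt_trans _ dx) // ltrN10.
  have := ler_wpM2l (q0 j) le1; have := ler_wpM2l (p0 j) le2.
  rewrite mulrDr mulrA; lra.
have D0 : 0 <= D by apply: sumr_ge0 => j _; rewrite mulr_ge0 // ltW.
have h00 : 0 <= h 0.
  rewrite leNgt; apply/negP => h0.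
  (* At this point the lower bound - D / x already exceeds h 0. *)
  pose x := (D + 1) / - h 0.
  have x0 : 0 < x by rewrite divr_gt0 ?oppr_gt0 ?ltr_wpDl.
  have := le_trans (h_ge x x0) (h_anti x (ltW x0)).
  rewrite lerNl ler_pdivlMr // /x mulrC divfK; last by rewrite oppr_eq0 lt_eqF.
  lra.
move: h00; rewrite /h sumrB subr_ge0.
by under eq_bigr do rewrite addr0; under [X in _ <= X]eq_bigr do rewrite addr0.
Qed.

(** Bolzano-Weierstrass for finitely many real sequences at once, in
    the form needed to pass to the limit along a minimizing sequence. *)
Lemma bounded_cluster (I : finType) (u : nat -> I -> R) (M : R) :
  (forall k i, `|u k i| <= M) ->
  exists l : I -> R, forall eps, 0 < eps -> forall K : nat,
    exists2 k, (K <= k)%N & forall i, `|u k i - l i| < eps.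
Proof.
move=> uM.
pose U k : 'rV[R]_#|I| := \row_j u k (enum_val j).
have cpt : compact [set v : 'rV[R]_#|I| | forall j, `[- M, M]%classic (v ord0 j)].
  by apply: (@rV_compact R _ (fun=> `[- M, M]%classic)) => j; apply: segment_compact.
have [|v [_ clv]] := cpt (U @ \oo) _.
  by exists 0 => // k _ j /=; rewrite in_itv /= -ler_norml /U mxE.
exists (fun i => v ord0 (enum_rank i)) => eps eps0 K.
have : (U @ \oo) (U @` [set k | (K <= k)%N]).
  by exists K => // k Kk; exists k.
move=> /clv /(_ (nbhsx_ballx v eps eps0)) [_ [[k Kk <-]]] bU.
exists k => // i; have [_ /(_ ord0 (enum_rank i))] := bU.
by rewrite /U mxE enum_rankK /ball /= distrC.
Qed.

Lemma le_of_le_add_eps (a b D : R) : 0 <= D ->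
  (forall eps, 0 < eps -> a <= b + D * eps) -> a <= b.
Proof.
move=> D0 h; rewrite leNgt; apply/negP => ba.
pose eps := (a - b) / (2 * (D + 1)).
have D1 : 0 < D + 1 by rewrite ltr_wpDl.
have e0 : 0 < eps by rewrite divr_gt0 ?subr_gt0 // mulr_gt0.
have E : (D + 1) * eps = (a - b) / 2 by rewrite /eps; field; rewrite gt_eqF.
have := h _ e0; nra.
Qed.

(** Second-order Taylor bound for [ln^2] at [d], from
    [1 - 1/x <= ln x <= x - 1] with [x = e / d].  Since [ln^2 e] is
    unbounded as [e] tends to [0], a lower bound [r] on [x] is required. *)
Lemma ln_sqr_le (r d e : R) : 0 < r -> r <= 1 -> 0 < d -> r * d <= e ->
  ln e ^+ 2 <= ln d ^+ 2 + 2 * ln d / d * (e - d)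
     + (2 * `|ln d| / r + r^-2) / d ^+ 2 * (e - d) ^+ 2.
Proof.
move=> r0 r1 d0 rd.
have e0 : 0 < e by rewrite (lt_le_trans _ rd) // mulr_gt0.
pose x := e / d.
have x0 : 0 < x by rewrite divr_gt0.
have rx : r <= x by rewrite ler_pdivlMr.
have -> : e - d = d * (x - 1) by rewrite mulrBr mulr1 mulrC divfK // gt_eqF.
have -> : ln e = ln d + ln x by rewrite /x ln_div ?posrE // addrC subrK.
have up : ln x <= x - 1.
  by have := @le_ln1Dx R (x - 1); rewrite [1 + _]addrC subrK; apply; lra.
have lo : 1 - x^-1 <= ln x.
  have := @le_ln1Dx R (x^-1 - 1); rewrite [1 + _]addrC subrK lnV ?posrE // => h.
  have : 0 < x^-1 by rewrite invr_gt0.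
  by lra.
have ne : d != 0 by rewrite gt_eqF.
have rne : r != 0 by rewrite gt_eqF.
have -> : 2 * ln d / d * (d * (x - 1)) = 2 * ln d * (x - 1) by field.
have -> : (2 * `|ln d| / r + r ^- 2) / d ^+ 2 * (d * (x - 1)) ^+ 2
  = 2 * `|ln d| * ((x - 1) ^+ 2 / r) + (x - 1) ^+ 2 / r ^+ 2 by field; apply/andP.
pose t := x - 1 - ln x.
have t0 : 0 <= t by rewrite subr_ge0.
have tr : t <= (x - 1) ^+ 2 / r.
  apply: le_trans (_ : (x - 1) ^+ 2 / x <= _).
    rewrite /t lerBlDr -lerBlDl (le_trans _ lo) // le_eqVlt; apply/orP; left.
    by apply/eqP; field; rewrite gt_eqF.
  by rewrite ler_wpM2l ?sqr_ge0 // lef_pV2.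
have q : ln x ^+ 2 <= (x - 1) ^+ 2 / r ^+ 2.
  rewrite -expr_div_n -ler_sqrt ?sqr_ge0 // !sqrtr_sqr.
  rewrite normrM normfV (gtr0_norm r0).
  have [x1|x1] := lerP 1 x.
    rewrite !ger0_norm ?subr_ge0 //; last by apply: ln_ge0.
    by rewrite (le_trans up) // ler_pdivlMr // ler_piMr // subr_ge0.
  have xl1 : x - 1 <= 0 by rewrite subr_le0 ltW.
  have lx0 : ln x <= 0 by apply: ln_le0; apply: ltW.
  rewrite !ler0_norm //.
  rewrite (le_trans (_ : _ <= - (x - 1) / x)) //.
    rewrite lerNl (le_trans _ lo) // le_eqVlt; apply/orP; left.
    by apply/eqP; field; rewrite gt_eqF.
  by rewrite opprB ler_wpM2l ?lef_pV2 ?posrE // subr_ge0 ltW.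
have E : ln d * ln x = ln d * (x - 1) - ln d * t by rewrite /t; ring.
have lt : - (ln d * t) <= `|ln d| * ((x - 1) ^+ 2 / r).
  apply: le_trans (_ : `|ln d| * t <= _); last by rewrite ler_wpM2l.
  by rewrite -mulNr ler_wpM2r // ler_normr lexx orbT.
rewrite sqrrD -mulr_natl -!mulrA E; move: lt q; rewrite -!mulrA; lra.
Qed.

(** Halving every [d i] leaves the [r] of [ln_sqr_le] valid; the
    perturbation of a minimizer will not move eigenvalues by more than that. *)
Lemma ratio_lower_bound m (d : 'I_m -> R) : (forall j, 0 < d j) ->
  exists r, [/\ 0 < r, r <= 1 & forall i j, r * d j <= d i / 2].
Proof.
move=> d0.
pose a := (1 + \sum_j (d j)^-1)^-1; pose b := 1 + \sum_j d j.
have di0 j : 0 <= (d j)^-1 by rewrite invr_ge0 ltW.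
have sa : 1 <= 1 + \sum_j (d j)^-1 by rewrite lerDl sumr_ge0.
have sb : 1 <= b by rewrite lerDl sumr_ge0 // => j _; rewrite ltW.
have a0 : 0 < a by rewrite invr_gt0 (lt_le_trans ltr01).
have a1 : a <= 1 by rewrite invf_le1 // (lt_le_trans ltr01).
have ad i : a <= d i.
  rewrite -[d i]invrK lef_pV2 ?posrE ?invr_gt0 //; last exact: lt_le_trans sa.
  rewrite (bigD1 i) //= addrCA lerDl addr_ge0 // sumr_ge0 // => j _.
have db j : d j <= b.
  rewrite /b (bigD1 j) //= addrCA lerDl addr_ge0 // sumr_ge0 // => k _.
  exact: ltW.
have b0 : 0 < b by rewrite (lt_le_trans ltr01).
exists (a / (2 * b)); split.
- by rewrite divr_gt0 // mulr_gt0.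
- by rewrite ler_pdivrMr ?mulr_gt0 // mul1r; lra.
- move=> i j; have -> : a / (2 * b) * d j = a / b * d j / 2 by field; rewrite gt_eqF.
  rewrite ler_pM2r ?invr_gt0 // (le_trans _ (ad i)) //.
  by rewrite mulrAC ler_pdivrMr // ler_wpM2l // ltW.
Qed.

(** The rule of Fermat: [c L + K c^2] will be an upper bound for the
    increment of a function at a minimum, which is enough to kill the slope. *)
Lemma linear_term_eq0 (L K c0 : R) : 0 < c0 -> 0 <= K ->
  (forall c, `|c| <= c0 -> 0 <= c * L + K * c ^+ 2) -> L = 0.
Proof.
move=> c00 K0 h; apply/eqP; rewrite -normr_le0 leNgt; apply/negP => L0.
pose t := Num.min c0 (`|L| / (2 * (K + 1))).
have K1 : 0 < K + 1 by rewrite ltr_wpDl.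
have t0 : 0 < t by rewrite lt_min c00 divr_gt0 // mulr_gt0.
have tL : K * t < `|L|.
  have : t <= `|L| / (2 * (K + 1)) by rewrite ge_min lexx orbT.
  rewrite ler_pdivlMr ?mulr_gt0 // => h1.
  have := mulr_ge0 K0 (ltW t0); nra.
have := h (- Num.sg L * t).
rewrite normrM normrN normr_sg -normr_gt0 L0 mul1r gtr0_norm //.
rewrite ge_min lexx => /(_ isT).
have -> : - Num.sg L * t * L = - (t * `|L|) by rewrite normrEsg; ring.
have -> : (- Num.sg L * t) ^+ 2 = t ^+ 2.
  by rewrite exprMn sqrrN sqr_sg -normr_gt0 L0 mul1r.
have : t * (K * t) < t * `|L| by rewrite ltr_pM2l.
nra.
Qed.

End Analysis.

Section Hermitian.
Variable R : realType.
Local Notation C := R[i].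
Local Notation conjC := Num.conj.

(** * Squared moduli, adjoints and entrywise bounds *)

Definition nsq (z : C) : R := complex.Re z ^+ 2 + complex.Im z ^+ 2.

Lemma nsq_ge0 z : 0 <= nsq z.
Proof. by rewrite addr_ge0 ?sqr_ge0. Qed.

Lemma mulCconj (z : C) : conjC z * z = (nsq z)%:C.
Proof. by rewrite add_Re2_Im2 mulrC normCK. Qed.

Lemma nsqE (z : C) : (nsq z)%:C = `|z| ^+ 2.
Proof. by rewrite add_Re2_Im2. Qed.

Lemma nsqM z1 z2 : nsq (z1 * z2) = nsq z1 * nsq z2.
Proof. by apply: complexI; rewrite rmorphM /= !nsqE normrM exprMn. Qed.

Lemma nsqC (r : R) : nsq r%:C = r ^+ 2.
Proof. by rewrite /nsq /= expr0n addr0. Qed.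

Lemma nsq_eq0 z : nsq z = 0 -> z = 0.
Proof.
move=> h; have /eqP := nsqE z; rewrite h eq_sym sqrf_eq0 normr_eq0.
by move/eqP.
Qed.

Lemma conjC_real (r : R) : conjC (r%:C) = r%:C.
Proof. exact: conjc_real. Qed.

Lemma adjM m n p (A : 'M[C]_(m, n)) (B : 'M[C]_(n, p)) :
  (A *m B)^t* = B^t* *m A^t*.
Proof. by rewrite trmx_mul map_mxM. Qed.

Lemma adjD m n (A B : 'M[C]_(m, n)) : (A + B)^t* = A^t* + B^t*.
Proof. by rewrite linearD map_mxD. Qed.

Lemma adjB m n (A B : 'M[C]_(m, n)) : (A - B)^t* = A^t* - B^t*.
Proof. by rewrite linearB map_mxB. Qed.

Lemma adjV m (A : 'M[C]_m) : (invmx A)^t* = invmx (A^t*).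
Proof. by rewrite trmx_inv map_invmx. Qed.

Lemma adj_unit m (A : 'M[C]_m) : (A^t* \in unitmx) = (A \in unitmx).
Proof. by rewrite map_unitmx unitmx_tr. Qed.

Lemma mxBE p q (M N : 'M[C]_(p, q)) i j : (M - N) i j = M i j - N i j.
Proof. by rewrite mxE [X in _ + X]mxE. Qed.

Lemma Re_sum I (r : seq I) (F : I -> C) :
  complex.Re (\sum_(j <- r) F j) = \sum_(j <- r) complex.Re (F j).
Proof. by apply: (big_morph (@complex.Re R)) => // -[a b] [c d]. Qed.

(** The variational formula for [|b|^2 / k], the one-dimensional case of
    [u^* M^-1 u = sup_x (2 Re (x^* u) - x^* M x)]. *)
Lemma Re_conj_mul_le (k : R) (a b : C) : 0 < k ->
  2 * complex.Re (conjC a * b) <= k * nsq a + nsq b / k.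
Proof.
case: a b => [a1 a2] [b1 b2] k0; rewrite /nsq /=.
rewrite -subr_ge0.
have -> : k * (a1 ^+ 2 + a2 ^+ 2) + (b1 ^+ 2 + b2 ^+ 2) / k
   - 2 * (a1 * b1 - - a2 * b2) = ((k * a1 - b1) ^+ 2 + (k * a2 - b2) ^+ 2) / k.
  by field; rewrite gt_eqF.
by rewrite divr_ge0 ?addr_ge0 ?sqr_ge0 // ltW.
Qed.

Lemma weighted_CauchySchwarz m (d : 'I_m -> R) (a b : 'I_m -> C) :
  (forall j, 0 < d j) ->
  nsq (\sum_j (d j)%:C * (conjC (a j) * b j))
   <= (\sum_j d j * nsq (a j)) * (\sum_j d j * nsq (b j)).
Proof.
move=> d0; pose u (f : 'I_m -> C) : 'rV[C]_m :=
  \row_j ((Num.sqrt (d j))%:C * conjC (f j)).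
have uu f g : dotmx (u f) (u g) = \sum_j (d j)%:C * (conjC (f j) * g j).
  rewrite dotmxE mxE; apply: eq_bigr => j _; rewrite !mxE rmorphM /= conjCK conjC_real.
  by rewrite mulrACA -rmorphM -expr2 sqr_sqrtr ?(ltW (d0 j)).
have nn f : \sum_j (d j)%:C * (conjC (f j) * f j) = (\sum_j d j * nsq (f j))%:C.
  by rewrite rmorph_sum; apply: eq_bigr => j _; rewrite mulCconj rmorphM.
have [+ _] := CauchySchwarz (@dotmx _ m) (u a) (u b).
by rewrite /= !uu !nn -nsqE -rmorphM lecR.
Qed.

Lemma Re_Im_le_norm (z : C) (a : R) : `|z| <= a%:C ->
  `|complex.Re z| <= a /\ `|complex.Im z| <= a.
Proof.
rewrite normc_def lecR => h.
by split; apply: le_trans h; rewrite -sqrtr_sqr ler_wsqrtr // ?lerDl ?lerDr sqr_ge0.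
Qed.

Lemma norm_le_ReIm (z : C) : `|z| <= (`|complex.Re z| + `|complex.Im z|)%:C.
Proof.
rewrite normc_def lecR -[X in _ <= X]ger0_norm ?addr_ge0 // -sqrtr_sqr ler_wsqrtr //.
rewrite sqrrD !real_normK ?num_real // -addrA [X in _ <= _ + X]addrC lerD2l lerDl.
by rewrite mulrn_wge0 // mulr_ge0.
Qed.

(** A crude norm: the statements below need only that products, traces
    and forms depend on the entries in a controlled way. *)
Definition entry_bounded p q (M : 'M[C]_(p, q)) (a : R) :=
  forall i j, `|M i j| <= a%:C.

Lemma entry_boundedM p q r (M : 'M[C]_(p, q)) (N : 'M[C]_(q, r)) a b :
  entry_bounded M a -> entry_bounded N b ->
  entry_bounded (M *m N) (q%:R * (a * b)).
Proof.
move=> hM hN i j; rewrite mxE (le_trans (ler_norm_sum _ _ _)) //.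
apply: le_trans (_ : \sum_(k < q) (a * b)%:C <= _).
  apply: ler_sum => k _; rewrite normrM rmorphM; by apply: ler_pM.
by rewrite sumr_const card_ord mulr_natl rmorphMn.
Qed.

Lemma entry_bounded_adj p q (M : 'M[C]_(p, q)) a :
  entry_bounded M a -> entry_bounded (M^t*) a.
Proof. by move=> hM i j; rewrite !mxE norm_conjC. Qed.

Lemma entry_bounded_ex p q (M : 'M[C]_(p, q)) :
  exists2 a, 0 <= a & entry_bounded M a.
Proof.
exists (\sum_i \sum_j complex.Re `|M i j|).
  by do 2 (apply: sumr_ge0 => ? _); rewrite normc_def sqrtr_ge0.
have n0 i j : 0 <= complex.Re `|M i j| by rewrite normc_def sqrtr_ge0.
move=> i j; rewrite -[X in X <= _]RRe_real ?normr_real // lecR.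
rewrite (bigD1 i) //= (bigD1 j) //= -addrA lerDl.
apply: addr_ge0; apply: sumr_ge0 => k _; first exact: n0.
by apply: sumr_ge0 => l _; exact: n0.
Qed.

Lemma entry_bounded_tr p (M : 'M[C]_p) a :
  entry_bounded M a -> complex.Re (\tr M) <= p%:R * a.
Proof.
move=> hM; rewrite /mxtrace Re_sum -[p%:R]/(p%:R) mulr_natl -[X in _ *+ X]card_ord -sumr_const.
apply: ler_sum => i _; rewrite -lecR.
apply: le_trans (hM i i); apply: le_trans (normc_ge_Re _).
by rewrite lecR ler_norm.
Qed.

Section Size.
Variable m : nat.
Implicit Types (A B X Y Z S T U H L : 'M[C]_m) (d e : 'I_m -> R) (x y v : 'cV[C]_m).

(** * Simultaneous diagonalization *)

Definition dmx d : 'M[C]_m := diag_mx (\row_j (d j)%:C).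

Lemma dmxE d i j : dmx d i j = (d i)%:C *+ (i == j).
Proof. by rewrite !mxE. Qed.

Lemma adj_dmx d : (dmx d)^t* = dmx d.
Proof.
apply/matrixP=> i j; rewrite !mxE eq_sym; case: eqP => [->|_].
  by rewrite !mulr1n conjC_real.
by rewrite !mulr0n conjC0.
Qed.

Lemma dmxM d e : dmx d *m dmx e = dmx (fun j => d j * e j).
Proof.
rewrite /dmx mulmx_diag; congr diag_mx; apply/rowP=> j.
by rewrite !mxE rmorphM.
Qed.

Lemma dmx1 d : (forall j, d j = 1) -> dmx d = 1%:M.
Proof. by move=> h; apply/matrixP=> i j; rewrite dmxE h mxE. Qed.

Lemma dmxZ r d : dmx (fun j => r * d j) = r%:C *: dmx d.
Proof.
by apply/matrixP=> i j; rewrite [RHS]mxE !dmxE rmorphM /= mulrnAr.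
Qed.

Lemma eq_dmx d e : d =1 e -> dmx d = dmx e.
Proof. by move=> h; apply/matrixP=> i j; rewrite !dmxE h. Qed.

Lemma dmx_unit d : (forall j, 0 < d j) -> dmx d \in unitmx.
Proof.
move=> hd; suff h : dmx d *m dmx (fun j => (d j)^-1) = 1%:M.
  by case/mulmx1_unit: h.
by rewrite dmxM; apply: dmx1 => j; rewrite divff ?gt_eqF.
Qed.

Lemma dmx_mulcol d x j : (dmx d *m x) j 0 = (d j)%:C * x j 0.
Proof. by rewrite mul_diag_mx !mxE. Qed.

Lemma sform d S T x y :
  (x^t* *m (S^t* *m dmx d *m T) *m y) 0 0
  = \sum_j (d j)%:C * (conjC ((S *m x) j 0) * (T *m y) j 0).
Proof.
rewrite !mulmxA -adjM -!mulmxA mxE; apply: eq_bigr => j _.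
by rewrite dmx_mulcol 2!mxE mulrCA.
Qed.

Lemma qform d S x :
  (x^t* *m (S^t* *m dmx d *m S) *m x) 0 0
  = (\sum_j d j * nsq ((S *m x) j 0))%:C.
Proof.
rewrite sform rmorph_sum; apply: eq_bigr => j _.
by rewrite mulCconj rmorphM.
Qed.

Definition simdiag A X S d := [/\ S \in unitmx, forall j, 0 < d j,
  A = S^t* *m S & X = S^t* *m dmx d *m S].

Lemma hermP A : reflect (A^t* = A) (A \is hermsymmx).
Proof. by rewrite is_hermitianmxE expr0 scale1r eq_sym; apply: eqP. Qed.

Lemma herm_congr A S : A^t* = A -> (S^t* *m A *m S)^t* = S^t* *m A *m S.
Proof. by move=> h; rewrite !adjM h trmxCK mulmxA. Qed.

Lemma herm_spectral A : A^t* = A ->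
  exists2 U, U \is unitarymx & exists d, A = U^t* *m dmx d *m U.
Proof.
move=> /hermP hA.
have hr := hermitian_spectral_diag_real hA.
have /orthomx_spectralP E := hermitian_normalmx hA.
have hu := spectral_unitarymx A.
exists (spectralmx A) => //.
exists (fun j => complex.Re (spectral_diag A 0 j)).
apply: (etrans E); rewrite (invmx_unitary hu); congr (_ *m diag_mx _ *m _).
apply/rowP=> j; rewrite mxE RRe_real //.
by move/mxOverP: hr; apply.
Qed.

Lemma unit_delta S j : S \in unitmx ->
  exists2 x : 'cV[C]_m, x != 0 & S *m x = delta_mx j 0.
Proof.
move=> uS; exists (invmx S *m delta_mx j 0); last by rewrite mulKVmx.
apply/eqP=> /(congr1 (mulmx S)); rewrite mulKVmx // mulmx0 => /matrixP/(_ j 0).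
by rewrite !mxE !eqxx => /eqP; rewrite oner_eq0.
Qed.

Lemma sum_delta d j :
  \sum_k d k * nsq ((delta_mx j 0 : 'cV[C]_m) k 0) = d j.
Proof.
rewrite (bigD1 j) //= big1 ?addr0 => [|k /negPf nkj].
  by rewrite mxE !eqxx (nsqC 1) expr1n mulr1.
by rewrite mxE nkj /= (nsqC 0) expr0n mulr0.
Qed.

Lemma sum_delta1 j : \sum_k nsq ((delta_mx j 0 : 'cV[C]_m) k 0) = 1.
Proof.
by rewrite -[RHS](sum_delta (fun=> 1) j); apply: eq_bigr => k _; rewrite mul1r.
Qed.

Lemma posdef_spectral A : posdefmx Num.conj A ->
  exists2 U, U \is unitarymx & exists2 d, (forall j, 0 < d j)
     & A = U^t* *m dmx d *m U.
Proof.
move=> [/hermP hA pA]; have [U uU [d Ed]] := herm_spectral hA.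
exists U => //; exists d => // j.
have [x x0 Ux] := unit_delta j (unitarymx_unit uU).
by have := pA _ x0; rewrite Ed qform ltcR Ux sum_delta.
Qed.

Lemma posdef_congr A S : S \in unitmx -> posdefmx Num.conj A ->
  posdefmx Num.conj (S^t* *m A *m S).
Proof.
move=> uS [/hermP hA pA]; split; first exact/hermP/herm_congr.
move=> x x0; rewrite !mulmxA -adjM -[_ *m S *m x]mulmxA; apply: pA.
by apply: contraNneq x0 => /(congr1 (mulmx (invmx S))); rewrite mulKmx // mulmx0 => ->.
Qed.

(** [A] has a factorization [S0^* S0] by the spectral theorem; the
    spectral theorem for [S0^-* X S0^-1] then diagonalizes [X] too, and the
    unitary factor it introduces does not change [A]. *)
Lemma simdiag_exists A X : posdefmx Num.conj A -> posdefmx Num.conj X ->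
  exists S d, simdiag A X S d.
Proof.
move=> pA pX; have [U uU [a a0 EA]] := posdef_spectral pA.
pose q j := Num.sqrt (a j).
have q0 j : 0 < q j by rewrite sqrtr_gt0.
pose S0 := dmx q *m U.
have uS0 : S0 \in unitmx.
  by rewrite unitmx_mul dmx_unit // unitarymx_unit.
have ES0 : S0^t* *m S0 = A.
  rewrite adjM adj_dmx EA !mulmxA -[_ *m dmx q *m dmx q]mulmxA dmxM.
  rewrite (@eq_dmx (fun j => q j * q j) a) // => j.
  by rewrite -expr2 sqr_sqrtr // ltW.
clearbody S0.
have uV : invmx S0 \in unitmx by rewrite unitmx_inv.
have [V uVV [d d0 EX]] := posdef_spectral (posdef_congr uV pX).
exists (V *m S0), d; split => //.
- by rewrite unitmx_mul uS0 unitarymx_unit.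
- have hV : V^t* *m V = 1%:M.
    by rewrite -invmx_unitary // mulVmx // unitarymx_unit.
  by rewrite adjM !mulmxA -[_ *m V^t* *m V]mulmxA hV mulmx1 ES0.
- have -> : X = S0^t* *m ((invmx S0)^t* *m X *m invmx S0) *m S0.
    by rewrite adjV !mulmxA mulmxV ?adj_unit // mul1mx mulmxKV.
  by rewrite EX adjM !mulmxA.
Qed.

Lemma simdiag_posdef A X S d : simdiag A X S d -> posdefmx Num.conj X.
Proof.
move=> [uS d0 _ ->]; split; first by apply/hermP/herm_congr/adj_dmx.
move=> x x0; rewrite qform (ltcR 0) lt_neqAle sumr_ge0 ?andbT; last first.
  by move=> j _; rewrite mulr_ge0 ?nsq_ge0 // ltW.
apply/negP; rewrite eq_sym psumr_eq0 => [/allP h|j _]; last first.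
  by rewrite mulr_ge0 ?nsq_ge0 // ltW.
case/eqP: x0; rewrite -[x](mulKmx uS); apply/eqP.
suff -> : S *m x = 0 by rewrite mulmx0.
apply/colP=> j; rewrite [RHS]mxE; apply: nsq_eq0.
have := h j (mem_index_enum j); rewrite /= mulf_eq0 gt_eqF //=.
by move/eqP.
Qed.

Lemma simdiag_sym A X S d : simdiag A X S d ->
  simdiag X A (dmx (fun j => Num.sqrt (d j)) *m S) (fun j => (d j)^-1).
Proof.
move=> [uS d0 -> ->].
have s0 j : 0 < Num.sqrt (d j) by rewrite sqrtr_gt0.
have sd j : Num.sqrt (d j) * Num.sqrt (d j) = d j by rewrite -expr2 sqr_sqrtr // ltW.
split.
- by rewrite unitmx_mul dmx_unit.
- by move=> j; rewrite invr_gt0.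
- rewrite adjM adj_dmx !mulmxA -[_ *m dmx _ *m dmx _]mulmxA dmxM.
  by rewrite (eq_dmx sd).
- rewrite adjM adj_dmx !mulmxA -[_ *m dmx _ *m dmx _]mulmxA dmxM.
  rewrite -[_ *m dmx _ *m dmx _]mulmxA dmxM dmx1 ?mulmx1 // => j.
  by rewrite /= mulrCA sd mulVf // gt_eqF.
Qed.

Lemma simdiag_scale A X S d s : 0 < s -> simdiag A X S d ->
  simdiag (s%:C *: A) X ((Num.sqrt s)%:C *: S) (fun j => d j / s).
Proof.
move=> s0 [uS d0 -> ->]; have q0 : 0 < Num.sqrt s by rewrite sqrtr_gt0.
have qq : Num.sqrt s * Num.sqrt s = s by rewrite -expr2 sqr_sqrtr // ltW.
have aS : ((Num.sqrt s)%:C *: S)^t* = (Num.sqrt s)%:C *: S^t*.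
  by rewrite linearZ map_mxZ /= conjC_real.
split.
- by rewrite unitmxZ // unitfE (fmorph_eq0 (real_complex R)) gt_eqF.
- by move=> j; rewrite divr_gt0.
- by rewrite aS -scalemxAl -scalemxAr scalerA -rmorphM qq.
- rewrite aS -!scalemxAl -scalemxAr scalerA -rmorphM qq /= scalemxAl scalemxAr -dmxZ.
  by rewrite (@eq_dmx (fun j => s * (d j / s)) d) // => j; rewrite mulrC divfK // gt_eqF.
Qed.

Lemma char_poly_conj (K : fieldType) (S D : 'M[K]_m) : S \in unitmx ->
  char_poly (invmx S *m D *m S) = char_poly D.
Proof.
move=> uS; rewrite /char_poly /char_poly_mx.
pose P := map_mx polyC S; pose Q := map_mx polyC (invmx S).
have QP : Q *m P = 1%:M by rewrite -map_mxM mulVmx // map_mx1.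
have -> : 'X%:M - map_mx polyC (invmx S *m D *m S)
    = Q *m ('X%:M - map_mx polyC D) *m P.
  rewrite mulmxBr mulmxBl !map_mxM -/P -/Q; congr (_ - _).
  by rewrite scalar_mxC -mulmxA QP mulmx1.
by rewrite !det_mulmx mulrAC -det_mulmx QP det1 mul1r.
Qed.

(** [A^-1 X] is similar to the diagonal matrix through [S]. *)
Lemma eigenvalues_simdiag A X S d : simdiag A X S d ->
  perm_eq (eigenvalues (map_mx idfun (invmx A *m X))) [seq (d j)%:C | j <- enum 'I_m].
Proof.
move=> [uS d0 -> ->].
rewrite map_mx_id //.
have -> : invmx (S^t* *m S) *m (S^t* *m dmx d *m S) = invmx S *m dmx d *m S.
  have uA : S^t* *m S \in unitmx by rewrite unitmx_mul adj_unit uS.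
  have E : S^t* *m S *m (invmx S *m dmx d *m S) = S^t* *m dmx d *m S.
    by rewrite -!mulmxA; congr (_ *m _); apply: mulKVmx.
  by rewrite -E; apply: mulKmx.
rewrite /eigenvalues; case: closed_field_poly_normal => r /= E.
apply: prod_XsubC_eq.
move: E; rewrite (monicP (char_poly_monic _)) scale1r => <-.
rewrite char_poly_conj // char_poly_trig; last first.
  by apply/is_trig_mxP => i j ij; rewrite dmxE -val_eqE ltn_eqF.
rewrite big_map big_enum; apply: eq_bigr => j _.
by rewrite dmxE eqxx.
Qed.

(** * The Loewner order in diagonal form *)

Lemma loewner_qform A B x : loewner_le Num.conj B A ->
  (x^t* *m B *m x) 0 0 <= (x^t* *m A *m x) 0 0.
Proof.
move=> [_ /(_ x)]; by rewrite mulmxBr mulmxBl [X in 0 <= X]mxE [X in _ + X]mxE subr_ge0.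
Qed.

Lemma loewner_of_qform A B : A^t* = A -> B^t* = B ->
  (forall x, (x^t* *m B *m x) 0 0 <= (x^t* *m A *m x) 0 0) ->
  loewner_le Num.conj B A.
Proof.
move=> hA hB h; split; first by apply/hermP; rewrite adjB hA hB.
by move=> x; rewrite mulmxBr mulmxBl mxBE subr_ge0.
Qed.

Lemma posdef_herm A : posdefmx Num.conj A -> A^t* = A.
Proof. by case=> /hermP. Qed.

Lemma qform1 S x : (x^t* *m (S^t* *m S) *m x) 0 0
  = (\sum_j nsq ((S *m x) j 0))%:C.
Proof.
rewrite -{1}[S^t*]mulmx1 -(@dmx1 (fun=> 1)) // qform.
by congr _%:C; apply: eq_bigr => j _; rewrite mul1r.
Qed.

Lemma sform1 S T x y :
  (x^t* *m (S^t* *m T) *m y) 0 0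
  = \sum_j (conjC ((S *m x) j 0) * (T *m y) j 0).
Proof.
rewrite -{1}[S^t*]mulmx1 -(@dmx1 (fun=> 1)) // sform.
by apply: eq_bigr => j _; rewrite mul1r.
Qed.

Lemma simdiag_ge A X S d (a : R) x : simdiag A X S d -> (forall j, a <= d j) ->
  a%:C * (x^t* *m A *m x) 0 0 <= (x^t* *m X *m x) 0 0.
Proof.
move=> [uS d0 -> ->] h; rewrite [X in _ <= X]qform qform1 -rmorphM lecR mulr_sumr.
by apply: ler_sum => j _; rewrite ler_wpM2r ?nsq_ge0.
Qed.

Lemma simdiag_le A X S d (a : R) x : simdiag A X S d -> (forall j, d j <= a) ->
  (x^t* *m X *m x) 0 0 <= a%:C * (x^t* *m A *m x) 0 0.
Proof.
move=> [uS d0 -> ->] h; rewrite [X in X <= _]qform qform1 -rmorphM lecR mulr_sumr.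
by apply: ler_sum => j _; rewrite ler_wpM2r ?nsq_ge0.
Qed.

Lemma simdiag_eig_ge A X S d (a : R) : simdiag A X S d ->
  (forall x, a%:C * (x^t* *m A *m x) 0 0 <= (x^t* *m X *m x) 0 0) ->
  forall j, a <= d j.
Proof.
move=> [uS d0 -> ->] h j; have [x _ Sx] := unit_delta j uS.
by have := h x; rewrite [X in _ <= X]qform qform1 Sx sum_delta sum_delta1 -rmorphM lecR mulr1.
Qed.

Lemma simdiag_eig_le A X S d (a : R) : simdiag A X S d ->
  (forall x, (x^t* *m X *m x) 0 0 <= a%:C * (x^t* *m A *m x) 0 0) ->
  forall j, d j <= a.
Proof.
move=> [uS d0 -> ->] h j; have [x _ Sx] := unit_delta j uS.
by have := h x; rewrite [X in X <= _]qform qform1 Sx sum_delta sum_delta1 mulr1 lecR.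
Qed.

Lemma loewner_refl A : A^t* = A -> loewner_le Num.conj A A.
Proof. by move=> hA; apply: loewner_of_qform. Qed.

Lemma loewner_antisym X Y : posdefmx Num.conj X -> posdefmx Num.conj Y ->
  loewner_le Num.conj X Y -> loewner_le Num.conj Y X -> X = Y.
Proof.
move=> pX pY XY YX; have [S [d sd]] := simdiag_exists pX pY.
have d1 j : d j = 1.
  apply: le_anti; apply/andP; split.
    by apply: (simdiag_eig_le sd) => x; rewrite mul1r; apply: loewner_qform.
  by apply: (simdiag_eig_ge sd) => x; rewrite mul1r; apply: loewner_qform.
by case: sd => _ _ -> ->; rewrite dmx1 // mulmx1.
Qed.

(** * Monotonicity of the relative entropy form *)

(** Both sides are of the form [u^* M^-1 u] with [u = Y v = Z v], the
    left one for [M = A + l Z] and the right one for [M = B + l Y], and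
    inversion reverses the order.  To avoid inverses, the vector [x] that
    attains the supremum in the variational formula for [A + l Z] is used as a
    test vector for [B + l Y]. *)
Lemma resolvent_anti Y B S d Z A T e v (l : R) :
    simdiag Y B S d -> simdiag Z A T e ->
    loewner_le Num.conj B A -> loewner_le Num.conj Y Z -> Y *m v = Z *m v ->
    0 <= l ->
  \sum_j nsq ((T *m v) j 0) / (e j + l) <= \sum_j nsq ((S *m v) j 0) / (d j + l).
Proof.
move=> [uS d0 EY EB] [uT e0 EZ EA] leBA leYZ Yv l0.
(* x = (A + l Z)^-1 (Z v), written in the coordinates of T. *)
pose a : 'cV[C]_m := \col_j (((e j + l)^-1)%:C * (T *m v) j 0).
pose x := invmx T *m a.
have Tx j : (T *m x) j 0 = ((e j + l)^-1)%:C * (T *m v) j 0.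
  by rewrite mulKVmx // mxE.
have el j : 0 < e j + l by rewrite ltr_wpDr.
have dl j : 0 < d j + l by rewrite ltr_wpDr.
set Q := \sum_j _ / _.
have hB : \sum_j d j * nsq ((S *m x) j 0) <= \sum_j e j * nsq ((T *m x) j 0).
  by have := loewner_qform x leBA; rewrite EB EA !qform lecR.
have hY : \sum_j nsq ((S *m x) j 0) <= \sum_j nsq ((T *m x) j 0).
  by have := loewner_qform x leYZ; rewrite EY EZ !qform1 lecR.
have hQ : \sum_j e j * nsq ((T *m x) j 0) + l * \sum_j nsq ((T *m x) j 0) = Q.
  rewrite mulr_sumr -big_split; apply: eq_bigr => j _ /=.
  rewrite Tx nsqM nsqC -mulrDl; field; rewrite gt_eqF //; exact: el.
have hv : \sum_j complex.Re (conjC ((S *m x) j 0) * (S *m v) j 0) = Q.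
  have : (x^t* *m Y *m v) 0 0 = (x^t* *m Z *m v) 0 0 by rewrite -!mulmxA Yv.
  rewrite EY EZ !sform1 => /(congr1 (@complex.Re R)); rewrite !Re_sum => ->.
  apply: eq_bigr => j _; rewrite Tx rmorphM /= conjC_real -mulrA mulCconj.
  by rewrite -rmorphM /= mulrC.
suff : 2 * Q <= Q + \sum_j nsq ((S *m v) j 0) / (d j + l) by lra.
rewrite -{1}hv mulr_sumr.
apply: le_trans (_ : \sum_j ((d j + l) * nsq ((S *m x) j 0) +
   nsq ((S *m v) j 0) / (d j + l)) <= _).
  by apply: ler_sum => j _; apply: Re_conj_mul_le.
rewrite big_split /= lerD2r -hQ.
under eq_bigr do rewrite mulrDl.
by rewrite big_split /= -mulr_sumr lerD // ler_wpM2l.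
Qed.

(** The forms compared are those of the relative entropies of [(Y, B)]
    and [(Z, A)].  Only vectors on which [Y] and [Z] agree are concerned: at
    these both forms are the derivative at [t = 0] of the weighted geometric
    means [v^* (Y #_t B) v], which are monotone and agree at [t = 0]. *)
Lemma entropy_mono Y B S d Z A T e v :
    simdiag Y B S d -> simdiag Z A T e ->
    loewner_le Num.conj B A -> loewner_le Num.conj Y Z -> Y *m v = Z *m v ->
  \sum_j nsq ((S *m v) j 0) * ln (d j) <= \sum_j nsq ((T *m v) j 0) * ln (e j).
Proof.
move=> sS sT leBA leYZ Yv; apply: ln_average_le.
- by move=> j; apply: nsq_ge0.
- by move=> j; apply: nsq_ge0.
- by case: sS.
- by case: sT.
- have : (v^t* *m Y *m v) 0 0 = (v^t* *m Z *m v) 0 0 by rewrite -!mulmxA Yv.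
  by case: sS sT => [_ _ -> _] [_ _ -> _]; rewrite !qform1 => /complexI.
- by move=> l l0; apply: (resolvent_anti sS sT).
Qed.

(** * The trace metric and an inequality of Klein type *)

Lemma trace_metric_simdiag A X S d : simdiag A X S d ->
  trace_metric idfun A X ^+ 2 = \sum_j ln (d j) ^+ 2.
Proof.
move=> sd; rewrite /trace_metric sqr_sqrtr; last first.
  by apply: sumr_ge0 => l _; apply: sqr_ge0.
rewrite (perm_big _ (eigenvalues_simdiag sd)) big_map big_enum.
by apply: eq_bigr => j _.
Qed.

Lemma trace_metric_simdiag_sym A X S d : simdiag A X S d ->
  trace_metric idfun X A ^+ 2 = \sum_j ln (d j) ^+ 2.
Proof.
move=> sd; rewrite (trace_metric_simdiag (simdiag_sym sd)).
by apply: eq_bigr => j _; case: sd => _ d0 _ _; rewrite lnV ?posrE // sqrrN.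
Qed.

Lemma adjmul_diag (M : 'M[C]_m) j :
  (M^t* *m M) j j = (\sum_k nsq (M k j))%:C.
Proof.
rewrite mxE rmorph_sum; apply: eq_bigr => k _.
by rewrite !mxE mulCconj.
Qed.

Lemma muladj_diag (M : 'M[C]_m) k :
  (M *m M^t*) k k = (\sum_j nsq (M k j))%:C.
Proof.
rewrite mxE rmorph_sum; apply: eq_bigr => j _.
by rewrite !mxE mulrC mulCconj.
Qed.

Lemma frobE (M : 'M[C]_m) : \tr (M^t* *m M) = (\sum_i \sum_j nsq (M i j))%:C.
Proof.
rewrite exchange_big rmorph_sum; apply: eq_bigr => j _.
by rewrite adjmul_diag.
Qed.

(** Relative to the common factor of [A], the bases that
    diagonalize [X] and [Y] differ by a unitary [U = T S^-1].  The squared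
    moduli of its entries couple the two spectra: averaging functions of
    [e k - d j] of degree at most two against [P] recovers the diagonal and
    the Frobenius norm of [K], the difference [Y - X] read in the basis of
    [X]. *)
Lemma overlap_bistochastic A X S d Y T e (K := (invmx S)^t* *m (Y - X) *m invmx S) :
    simdiag A X S d -> simdiag A Y T e ->
  exists P : 'I_m -> 'I_m -> R,
  [/\ forall k j, 0 <= P k j,
      forall j, \sum_k P k j = 1,
      forall k, \sum_j P k j = 1,
      forall j, \sum_k P k j * (e k - d j) = complex.Re (K j j)
    & \sum_k \sum_j P k j * (e k - d j) ^+ 2 = \sum_i \sum_j nsq (K i j)].
Proof.
move=> [uS d0 EA EX] [uT e0 EA' EY].
pose U := T *m invmx S.
have UU : U^t* *m U = 1%:M.
  rewrite adjM !mulmxA -[_ *m T^t* *m T]mulmxA -EA' EA.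
  by rewrite adjV !mulmxA mulVmx ?adj_unit // mul1mx mulmxV.
have UU' : U *m U^t* = 1%:M by apply: mulmx1C.
have EK : K = U^t* *m dmx e *m U - dmx d.
  rewrite /K mulmxBr mulmxBl EX EY adjM !mulmxA; congr (_ - _).
  by rewrite adjV mulVmx ?adj_unit // mul1mx mulmxK.
clearbody K; clearbody U.
exists (fun k j => nsq (U k j)); split.
- by move=> k j; apply: nsq_ge0.
- by move=> j; apply: complexI; rewrite -adjmul_diag UU mxE eqxx.
- by move=> k; apply: complexI; rewrite -muladj_diag UU' mxE eqxx.
- move=> j; rewrite EK.
  have -> : (U^t* *m dmx e *m U - dmx d) j j =
     (\sum_k nsq (U k j) * (e k - d j))%:C; last by [].
  rewrite mxBE dmxE eqxx mulr1n.
  rewrite -[X in - X]mulr1 -(_ : (\sum_k nsq (U k j))%:C = 1); last first.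
    by rewrite -adjmul_diag UU mxE eqxx.
  rewrite -rmorphM /= mulr_sumr mxE !rmorph_sum -sumrB; apply: eq_bigr => k _.
  rewrite mul_mx_diag !mxE mulrAC mulCconj -!rmorphM -rmorphB /=; congr _%:C.
  ring.
- apply: complexI; rewrite -frobE.
  have -> : K^t* *m K = (U *m K)^t* *m (U *m K).
    by rewrite adjM -!mulmxA [U^t* *m (U *m _)]mulmxA UU mul1mx.
  rewrite frobE; congr _%:C; apply: eq_bigr => k _; apply: eq_bigr => j _.
  have -> : U *m K = dmx e *m U - U *m dmx d.
    by rewrite EK mulmxBr !mulmxA UU' mul1mx.
  rewrite mxBE mul_diag_mx mul_mx_diag !mxE.
  by rewrite [U k j * _]mulrC -mulrBl -rmorphB nsqM nsqC mulrC.
Qed.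

(** Averaging a scalar inequality between [f (e k)] and [f (d j)] against
    the doubly stochastic coupling turns it into an inequality between trace
    functions, as in the proof of Klein's inequality.  The slope [g] is free:
    the derivative of [f] gives a first-order expansion, and [g = 0] with a
    positive [eta] gives uniform continuity. *)
Lemma klein_bound A X S d Y T e (f : R -> R) (g : 'I_m -> R) (eta c : R)
    (K := (invmx S)^t* *m (Y - X) *m invmx S) :
    simdiag A X S d -> simdiag A Y T e ->
    (forall k j, f (e k) <= f (d j) + g j * (e k - d j) + eta
         + c * (e k - d j) ^+ 2) ->
  \sum_k f (e k) <= \sum_j f (d j) + \sum_j g j * complex.Re (K j j)
     + m%:R * eta + c * \sum_i \sum_j nsq (K i j).
Proof.
move=> sX sY h; have [P [P0 Pc Pr P1 P2]] := overlap_bistochastic sX sY.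
rewrite -/K in P1 P2.
have -> : \sum_k f (e k) = \sum_k \sum_j P k j * f (e k).
  by apply: eq_bigr => k _; rewrite -mulr_suml Pr mul1r.
have -> : \sum_j f (d j) = \sum_k \sum_j P k j * f (d j).
  rewrite exchange_big; by apply: eq_bigr => j _; rewrite -mulr_suml Pc mul1r.
have -> : \sum_j g j * complex.Re (K j j)
    = \sum_k \sum_j P k j * (g j * (e k - d j)).
  rewrite exchange_big; apply: eq_bigr => j _; rewrite -P1 mulr_sumr.
  by apply: eq_bigr => k _; rewrite mulrCA.
have -> : m%:R * eta = \sum_k \sum_j P k j * eta.
  under eq_bigr do rewrite -mulr_suml Pr mul1r.
  by rewrite sumr_const card_ord mulr_natl.
rewrite -P2 mulr_sumr -!big_split /=; apply: ler_sum => k _.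
rewrite mulr_sumr -!big_split /=; apply: ler_sum => j _.
by rewrite -!mulrDr mulrCA -!mulrDr ler_wpM2l.
Qed.

(** * Stationarity of minimizers *)

Lemma col_mul_adj x i j : (x *m x^t*) i j = x i 0 * conjC (x j 0).
Proof. by rewrite mxE big_ord1 !mxE. Qed.

(** The rank-one direction [(X v)(X v)^*] makes both sides explicit:
    by Cauchy-Schwarz [|x^* X v|^2 <= (x^* X x)(v^* X v)], so small multiples
    keep [Y >= X / 2], and in the basis of [X] the direction is [z z^*] with
    [z = D S v]. *)
Lemma trace_metric_perturb A X S d v : simdiag A X S d ->
  exists K c0, [/\ 0 < c0, 0 <= K & forall c, `|c| <= c0 ->
    let Y := X + c%:C *: ((X *m v) *m (X *m v)^t*) in
    posdefmx Num.conj Y /\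
    trace_metric idfun Y A ^+ 2 <= trace_metric idfun X A ^+ 2
       + c * (2 * \sum_j nsq ((S *m v) j 0) * (d j * ln (d j))) + K * c ^+ 2].
Proof.
move=> sX; have [uS d0 EA EX] := sX.
have pA : posdefmx Num.conj A.
  by apply: (simdiag_posdef (simdiag_sym sX)).
have [r [r0 r1 hr]] := ratio_lower_bound d0.
pose Q := \sum_j d j * nsq ((S *m v) j 0).
have Q0 : 0 <= Q by apply: sumr_ge0 => j _; rewrite mulr_ge0 ?nsq_ge0 // ltW.
pose cst j := (2 * `|ln (d j)| / r + r^-2) / d j ^+ 2.
pose N := \sum_i \sum_j nsq ((dmx d *m (S *m v) *m (dmx d *m (S *m v))^t*) i j).
have N0 : 0 <= N by do 2 (apply: sumr_ge0 => ? _); apply: nsq_ge0.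
have cst0 j : 0 <= cst j.
  rewrite divr_ge0 ?sqr_ge0 // addr_ge0 ?invr_ge0 ?sqr_ge0 //.
  by rewrite divr_ge0 ?mulr_ge0 // ltW.
(* Q = v^* X v; the 1 keeps the radius positive when v = 0. *)
exists ((\sum_j cst j) * N), (2 * (1 + Q))^-1; split.
- by rewrite invr_gt0 mulr_gt0 // ltr_wpDr.
- by rewrite mulr_ge0 // sumr_ge0.
move=> c hc Y.
have hX : X^t* = X by rewrite EX herm_congr // adj_dmx.
have hY : Y^t* = Y.
  by rewrite /Y adjD hX linearZ map_mxZ /= conjC_real adjM trmxCK.
have half x : (2^-1)%:C * (x^t* *m X *m x) 0 0 <= (x^t* *m Y *m x) 0 0.
  have -> : (x^t* *m Y *m x) 0 0 = (x^t* *m X *m x) 0 0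
      + c%:C * (nsq ((x^t* *m X *m v) 0 0))%:C.
    rewrite mulmxDr mulmxDl mxE -scalemxAr -scalemxAl [X in _ + X]mxE.
    congr (_ + _ * _); rewrite -mulCconj mulrC.
    have -> : conjC ((x^t* *m X *m v) 0 0) = ((X *m v)^t* *m x) 0 0.
      have -> : (X *m v)^t* *m x = (x^t* *m X *m v)^t*.
        by rewrite -[x^t* *m X *m v]mulmxA [RHS]adjM trmxCK.
      by rewrite !mxE.
    by rewrite !mulmxA -[_ *m _^t* *m x]mulmxA [LHS]mxE big_ord1.
  rewrite EX qform sform -rmorphM -rmorphM -rmorphD lecR.
  set P := \sum_j _; set z := \sum_j _.
  have CS : nsq z <= P * Q by apply: weighted_CauchySchwarz.
  have P0 : 0 <= P by apply: sumr_ge0 => j _; rewrite mulr_ge0 ?nsq_ge0 // ltW.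
  have h1 : `|c| * nsq z <= 2^-1 * P.
    apply: le_trans (_ : (2 * (1 + Q))^-1 * (P * Q) <= _).
      by apply: ler_pM => //; apply: nsq_ge0.
    rewrite mulrC ler_pdivrMr ?mulr_gt0 ?ltr_wpDr //.
    rewrite mulrACA mulVf ?pnatr_eq0 // mul1r ler_wpM2l //; lra.
  have h2 : - (`|c| * nsq z) <= c * nsq z.
    by rewrite -mulNr ler_wpM2r ?nsq_ge0 // lerNl ler_normr lexx orbT.
  lra.
have pY : posdefmx Num.conj Y.
  split; first exact/hermP.
  move=> x x0; apply: lt_le_trans (half x).
  apply: mulr_gt0; first by rewrite (ltcR 0) invr_gt0.
  by have [_] := simdiag_posdef sX; apply.
split => //.
have DY : Y - X = c%:C *: ((X *m v) *m (X *m v)^t*) by rewrite /Y addrAC subrr add0r.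
clearbody Y.
have [T [e sY]] := simdiag_exists pA pY.
have E1 := trace_metric_simdiag_sym sX.
have E2 := trace_metric_simdiag_sym sY.
move: E1 E2; generalize (trace_metric idfun X A) (trace_metric idfun Y A).
move=> a b -> ->.
have ed k j : r * d j <= e k.
  apply: (simdiag_eig_ge sY) => x.
  apply: le_trans (half x).
  have : forall i, 2 * (r * d j) <= d i.
    by move=> i; have := hr i j; lra.
  move=> /(simdiag_ge x sX) h.
  have -> : (r * d j)%:C = (2^-1)%:C * (2 * (r * d j))%:C.
    by rewrite -rmorphM mulKf // pnatr_eq0.
  by rewrite -mulrA ler_wpM2l // (lecR 0) invr_ge0.
have EK : (invmx S)^t* *m (Y - X) *m invmx S =
    c%:C *: (dmx d *m (S *m v) *m (dmx d *m (S *m v))^t*).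
  rewrite DY -scalemxAr -scalemxAl; congr (_ *: _).
  have -> : dmx d *m (S *m v) = (invmx S)^t* *m (X *m v).
    by rewrite EX -!mulmxA adjV mulKmx ?adj_unit.
  by rewrite [in RHS]adjM trmxCK !mulmxA.
have H k j : ln (e k) ^+ 2 <= ln (d j) ^+ 2 + 2 * ln (d j) / d j * (e k - d j)
    + 0 + (\sum_j cst j) * (e k - d j) ^+ 2.
  rewrite addr0 (le_trans (ln_sqr_le r0 r1 (d0 j) (ed k j))) //.
  rewrite lerD2l ler_wpM2r ?sqr_ge0 // (bigD1 j) //= lerDl sumr_ge0 //.
have := klein_bound (f := fun t => ln t ^+ 2) sX sY H.
rewrite EK => /le_trans; apply; rewrite mulr0 addr0.
rewrite le_eqVlt; apply/orP; left; apply/eqP; congr (_ + _ + _).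
- rewrite mulrA mulr_sumr; apply: eq_bigr => j _.
  have -> : (c%:C *: (dmx d *m (S *m v) *m (dmx d *m (S *m v)) ^t*)) j j =
     (c * (d j ^+ 2 * nsq ((S *m v) j 0)))%:C.
    rewrite mxE col_mul_adj dmx_mulcol rmorphM /= conjC_real.
    rewrite mulrACA -rmorphM -expr2 [X in _ * (_ * X) = _]mulrC mulCconj.
    by rewrite -!rmorphM.
  by rewrite /=; field; rewrite gt_eqF.
- rewrite -mulrA; congr (_ * _); rewrite mulrC mulr_sumr; apply: eq_bigr => i _.
  rewrite mulr_sumr; apply: eq_bigr => j _.
  by rewrite [in LHS]mxE nsqM nsqC.
Qed.

Definition minimizer n (w : 'I_n -> R) (A : 'I_n -> 'M[C]_m) X :=
  posdefmx Num.conj X /\ forall Y, posdefmx Num.conj Y ->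
    least_squares idfun w A X <= least_squares idfun w A Y.

(** The Karcher equation, tested on the vector [v]. *)
Lemma minimizer_stationary n (w : 'I_n -> R) (A : 'I_n -> 'M[C]_m) X
    (S : 'I_n -> 'M[C]_m) (d : 'I_n -> 'I_m -> R) v :
    (forall i, 0 < w i) -> minimizer w A X ->
    (forall i, simdiag X (A i) (S i) (d i)) ->
  \sum_i w i * \sum_j nsq ((S i *m v) j 0) * ln (d i j) = 0.
Proof.
move=> w0 [pX minX] sX.
have [i0 _|ne] := pickP (fun _ : 'I_n => true); last exact: big_pred0.
have sA i := simdiag_sym (sX i).
have /choice [K hK] i := trace_metric_perturb v (sA i).
have /choice [c hc] := hK.
pose cm := \big[Num.min/1]_i c i.
have cm0 : 0 < cm.
  by rewrite /cm; elim/big_ind: _ => // [x y x0 y0|i _]; [rewrite lt_min x0|case: (hc i)].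
have cml i : cm <= c i by rewrite /cm (bigD1 i) //= ge_min lexx.
set L := \sum_i _.
(* The slope in direction t is - 2 L: passing from (A_i, X) to (X, A_i)
   inverts the eigenvalues. *)
suff : - (2 * L) = 0 by lra.
apply: (@linear_term_eq0 R _ (\sum_i w i * K i) cm) => //.
  by apply: sumr_ge0 => i _; rewrite mulr_ge0 ?(ltW (w0 i)) //; case: (hc i).
move=> t tc; pose Y := X + t%:C *: ((X *m v) *m (X *m v)^t*).
have hY i := let: And3 _ _ h := hc i in h t (le_trans tc (cml i)).
have pY : posdefmx Num.conj Y by case: (hY i0).
have := minX _ pY; rewrite -subr_ge0 => /le_trans; apply.
rewrite /least_squares -sumrB /L mulr_sumr -sumrN mulr_sumr mulr_suml -big_split.
apply: ler_sum => i _; rewrite -mulrBr -mulrA.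
have -> : t * - (2 * (w i * (\sum_j nsq ((S i *m v) j 0) * ln (d i j)))) =
  w i * (t * - (2 * (\sum_j nsq ((S i *m v) j 0) * ln (d i j)))) by ring.
rewrite /= -mulrDr ler_pM2l // lerBlDr.
have [_ ] := hY i; rewrite -/Y => /le_trans; apply.
rewrite [X in _ <= X]addrC addrA lerD2r lerD2l le_eqVlt; apply/orP; left.
apply/eqP; rewrite -mulrN; congr (_ * (_ * _)).
rewrite -sumrN; apply: eq_bigr => j _.
have [_ d0 _ _] := sX i.
rewrite -mulmxA dmx_mulcol nsqM nsqC sqr_sqrtr ?(ltW (d0 j)) // lnV ?posrE //.
by field; rewrite gt_eqF.
Qed.

(** * Monotonicity and uniqueness of minimizers *)

(** If [Y <= X] fails, the smallest [s] with [Y <= s X] exceeds [1] and is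
    the largest eigenvalue of [X^-1 Y].  At an eigenvector the entropy
    comparison contradicts the two Karcher equations. *)
Lemma minimizer_mono n (w : 'I_n -> R) (A B : 'I_n -> 'M[C]_m) X Y :
    (forall i, 0 < w i) -> \sum_i w i = 1 ->
    (forall i, posdefmx Num.conj (A i)) -> (forall i, posdefmx Num.conj (B i)) ->
    (forall i, loewner_le Num.conj (B i) (A i)) ->
    minimizer w A X -> minimizer w B Y ->
  loewner_le Num.conj Y X.
Proof.
move=> w0 w1 pA pB leBA minX minY.
have [pX _] := minX; have [pY _] := minY.
have [S [y sXY]] := simdiag_exists pX pY.
have [uS y0 EX EY] := sXY.
have [le1|/existsNP [j /negP]] := pselect (forall j, y j <= 1).
  apply: loewner_of_qform; [exact: posdef_herm|exact: posdef_herm|].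
  by move=> x; have := simdiag_le x sXY le1; rewrite mul1r.
rewrite -ltNge => yj.
have [j0 _ jmax] := @Order.TotalTheory.arg_maxP _ _ _ j xpredT y isT.
set s := y j0 in jmax.
have s1 : 1 < s by apply: lt_le_trans yj (jmax j isT).
have s0 : 0 < s by apply: lt_trans s1.
have [v _ Sv] := unit_delta j0 uS.
(* With Z = s X: Y <= Z, and Y v = Z v at the eigenvector v for s. *)
pose Z := s%:C *: X.
have Yv : Y *m v = Z *m v.
  rewrite EY /Z EX -scalemxAl -!mulmxA Sv scalemxAr; congr (_ *m _).
  apply/colP=> k; rewrite dmx_mulcol [in RHS]mxE !mxE.
  by case: eqP => [->|_] //; rewrite !mulr0.
have leYZ : loewner_le Num.conj Y Z.
  apply: loewner_of_qform; last 1 first.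
  - move=> x; rewrite /Z -scalemxAr -scalemxAl [X in _ <= X]mxE.
    by apply: (simdiag_le x sXY) => k; apply: jmax.
  - by rewrite /Z linearZ map_mxZ /= conjC_real posdef_herm.
  - exact: posdef_herm.
have /choice [TA /choice [dA sA]] i := simdiag_exists pX (pA i).
have /choice [TB /choice [dB sB]] i := simdiag_exists pY (pB i).
have mono i := entropy_mono (sB i) (simdiag_scale s0 (sA i)) (leBA i) leYZ Yv.
have statA := minimizer_stationary v w0 minX sA.
have statB := minimizer_stationary v w0 minY sB.
have scaled i : \sum_k nsq ((((Num.sqrt s)%:C *: TA i) *m v) k 0) * ln (dA i k / s)
    = s * (\sum_k nsq ((TA i *m v) k 0) * ln (dA i k)) - s * ln s.
  have one : \sum_k nsq ((TA i *m v) k 0) = 1.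
    apply: complexI; rewrite -qform1; have [_ _ <- _] := sA i.
    by rewrite EX qform1 Sv sum_delta1.
  rewrite -[X in _ - X]mulr1 -one !mulr_sumr -sumrB; apply: eq_bigr => k _.
  have [_ dA0 _ _] := sA i.
  rewrite -scalemxAl [((_ *: _) : 'cV_m) _ _]mxE nsqM nsqC sqr_sqrtr ?(ltW s0) //.
  by rewrite ln_div ?posrE //; ring.
have : \sum_i w i * (\sum_k nsq ((TB i *m v) k 0) * ln (dB i k)) <=
   \sum_i w i * (s * (\sum_k nsq ((TA i *m v) k 0) * ln (dA i k)) - s * ln s).
  by apply: ler_sum => i _; rewrite ler_wpM2l ?(ltW (w0 i)) // -scaled.
rewrite statB.
under [X in _ <= X]eq_bigr do rewrite mulrBr mulrCA.
rewrite sumrB -mulr_sumr statA mulr0 sub0r -mulr_suml w1 mul1r => h.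
by have := mulr_gt0 s0 (ln_gt0 s1); lra.
Qed.

(** * Existence of minimizers *)

(** Order intervals, expressed by quadratic forms because these pass to
    entrywise limits directly. *)
Definition sandwiched (lo hi : R) A X :=
  forall x, lo%:C * (x^t* *m A *m x) 0 0 <= (x^t* *m X *m x) 0 0
          /\ (x^t* *m X *m x) 0 0 <= hi%:C * (x^t* *m A *m x) 0 0.

Lemma sandwiched_eig lo hi A X S d : simdiag A X S d ->
  sandwiched lo hi A X -> forall j, lo <= d j <= hi.
Proof.
move=> sX h j; apply/andP; split.
  by apply: (simdiag_eig_ge sX) => x; case: (h x).
by apply: (simdiag_eig_le sX) => x; case: (h x).
Qed.

(** The squared Frobenius norm of [S^-* H S^-1] equals
    [tr (A^-1 H^* A^-1 H)], hence it is controlled by [A] and [H] alone even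
    though [S] varies with the second matrix of the pair. *)
Lemma congr_frob_bound A X S d H p h : simdiag A X S d ->
  entry_bounded (invmx A) p -> entry_bounded H h ->
  \sum_i \sum_j nsq (((invmx S)^t* *m H *m invmx S) i j)
    <= m%:R ^+ 4 * p ^+ 2 * h ^+ 2.
Proof.
move=> [uS _ EA _] hp hh; set K := _ *m invmx S.
have -> : \sum_i \sum_j nsq (K i j) = complex.Re (\tr (K^t* *m K)) by rewrite frobE.
have -> : \tr (K^t* *m K) = \tr (invmx A *m H^t* *m (invmx A *m H)).
  have EV : invmx A = invmx S *m (invmx S)^t*.
    rewrite EA adjV; apply: (can_inj (mulKmx (_ : S^t* *m S \in unitmx))).
      by rewrite unitmx_mul adj_unit uS.
    rewrite mulmxV ?unitmx_mul ?adj_unit ?uS // -mulmxA mulKVmx //.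
    by rewrite mulmxV // adj_unit.
  have -> : K^t* *m K = (invmx S)^t* *m (H^t* *m invmx A *m H *m invmx S).
    by rewrite /K !adjM trmxCK EV !mulmxA.
  by rewrite mxtrace_mulC -!mulmxA -EV !mulmxA mxtrace_mulC !mulmxA.
have b1 := entry_boundedM hp (entry_bounded_adj hh).
have b2 := entry_boundedM hp hh.
apply: le_trans (entry_bounded_tr (entry_boundedM b1 b2)) _.
by rewrite le_eqVlt; apply/orP; left; apply/eqP; ring.
Qed.

(** On an order interval the squared distance to [A] is uniformly
    continuous.  In [klein_bound] the slope is taken to be [0], the linear
    term of [ln_sqr_le] being absorbed by [2 a t <= eta + a^2 t^2 / eta]. *)
Lemma trace_metric_uniform A lo hi : posdefmx Num.conj A -> 0 < lo -> lo <= hi ->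
  forall eta, 0 < eta -> exists2 eps, 0 < eps & forall X Y,
    posdefmx Num.conj X -> posdefmx Num.conj Y ->
    sandwiched lo hi A X -> sandwiched lo hi A Y ->
    entry_bounded (Y - X) eps ->
    trace_metric idfun Y A ^+ 2 <= trace_metric idfun X A ^+ 2 + eta.
Proof.
move=> pA lo0 lohi eta eta0.
have hi0 : 0 < hi by apply: lt_le_trans lohi.
pose r := lo / hi.
have r0 : 0 < r by rewrite divr_gt0.
have r1 : r <= 1 by rewrite ler_pdivrMr // mul1r.
(* b bounds |ln| on [lo, hi]; klein_bound contributes m copies of eta'. *)
pose b := `|ln lo| + `|ln hi|.
pose eta' := eta / (2 * (m%:R + 1)).
have m0 : 0 < m%:R + 1 :> R by rewrite ltr_wpDl // ler0n.
have eta'0 : 0 < eta' by rewrite divr_gt0 // mulr_gt0.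
pose c := (b / lo) ^+ 2 / eta' + (2 * b / r + r^-2) / lo ^+ 2.
have b0 : 0 <= b by rewrite addr_ge0.
have c0 : 0 <= c.
  by rewrite addr_ge0 // divr_ge0 ?sqr_ge0 ?addr_ge0 ?invr_ge0 ?sqr_ge0 ?divr_ge0 ?mulr_ge0 // ltW.
have [p p0 hp] := entry_bounded_ex (invmx A).
pose D := c * (m%:R ^+ 4 * p ^+ 2).
have D0 : 0 <= D by rewrite mulr_ge0 // mulr_ge0 ?exprn_ge0 ?ler0n.
pose eps := Num.min 1 (eta / (2 * (D + 1))).
have D1 : 0 < D + 1 by rewrite ltr_wpDl.
have eps0 : 0 < eps by rewrite lt_min ltr01 divr_gt0 // mulr_gt0.
have Deps : D * eps ^+ 2 <= eta / 2.
  have e1 : eps <= 1 by rewrite ge_min lexx.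
  have : eps <= eta / (2 * (D + 1)) by rewrite ge_min lexx orbT.
  rewrite ler_pdivlMr ?mulr_gt0 // => h1.
  have : D * eps ^+ 2 <= D * eps.
    by rewrite ler_wpM2l // expr2 ler_piMr // ltW.
  have := mulr_ge0 D0 (ltW eps0); nra.
exists eps => // X Y pX pY hX hY hH.
have [S [d sX]] := simdiag_exists pA pX.
have [T [e sY]] := simdiag_exists pA pY.
have dX := sandwiched_eig sX hX; have eY := sandwiched_eig sY hY.
have scal k j : ln (e k) ^+ 2 <= ln (d j) ^+ 2 + 0 * (e k - d j) + eta'
     + c * (e k - d j) ^+ 2.
  have /andP[dlo dhi] := dX j; have /andP[elo ehi] := eY k.
  have d0 : 0 < d j by apply: lt_le_trans dlo.
  have rd : r * d j <= e k.
    by rewrite (le_trans _ elo) // /r mulrAC ler_pdivrMr // ler_wpM2l // ltW.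
  apply: le_trans (ln_sqr_le r0 r1 d0 rd) _.
  have lb : `|ln (d j)| <= b.
    rewrite ler_norml /b; apply/andP; split.
      have : ln lo <= ln (d j) by rewrite ler_ln.
      have := ler_norm (- ln lo); rewrite normrN.
      have := normr_ge0 (ln hi); lra.
    have : ln (d j) <= ln hi by rewrite ler_ln.
    have := ler_norm (ln hi); have := normr_ge0 (ln lo); lra.
  rewrite mul0r addr0 -!addrA lerD2l.
  set t := e k - d j.
  have h1 : 2 * ln (d j) / d j * t <= eta' + (b / lo) ^+ 2 / eta' * t ^+ 2.
    have q1 : (ln (d j) / d j) ^+ 2 <= (b / lo) ^+ 2.
      rewrite -[X in X <= _]real_normK ?num_real // ler_sqr ?nnegrE ?divr_ge0 ?(ltW lo0) //.
      rewrite normrM normfV (gtr0_norm d0) ler_pM ?invr_ge0 ?(ltW d0) //.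
      by rewrite lef_pV2.
    have q2 : (ln (d j) / d j) ^+ 2 / eta' * t ^+ 2 <= (b / lo) ^+ 2 / eta' * t ^+ 2.
      by rewrite ler_wpM2r ?sqr_ge0 // ler_wpM2r // invr_ge0 ltW.
    apply: le_trans (_ : eta' + (ln (d j) / d j) ^+ 2 / eta' * t ^+ 2 <= _); last first.
      by rewrite lerD2l.
    rewrite -subr_ge0.
    have -> : eta' + (ln (d j) / d j) ^+ 2 / eta' * t ^+ 2 - 2 * ln (d j) / d j * t =
        (eta' - ln (d j) / d j * t) ^+ 2 / eta'.
      by field; rewrite (gt_eqF eta'0) (gt_eqF d0).
    by rewrite divr_ge0 ?sqr_ge0 // ltW.
  have h2 : (2 * `|ln (d j)| / r + r ^- 2) / d j ^+ 2 * t ^+ 2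
      <= (2 * b / r + r^-2) / lo ^+ 2 * t ^+ 2.
    rewrite ler_wpM2r ?sqr_ge0 //; apply: ler_pM; rewrite ?invr_ge0 ?sqr_ge0 //.
    - apply: addr_ge0; last by rewrite invr_ge0 sqr_ge0.
      by apply: divr_ge0; [apply: mulr_ge0|exact: ltW].
    - by rewrite lerD2r ler_wpM2r ?invr_ge0 ?(ltW r0) // ler_wpM2l.
    - by rewrite lef_pV2 ?posrE ?exprn_gt0 // ler_sqr ?nnegrE // ltW.
  by rewrite /c [X in _ <= _ + X]mulrDl addrA lerD.
have := klein_bound (f := fun t => ln t ^+ 2) (g := fun=> 0) sX sY scal.
have E1 := trace_metric_simdiag_sym sX.
have E2 := trace_metric_simdiag_sym sY.
move: E1 E2; generalize (trace_metric idfun X A) (trace_metric idfun Y A).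
move=> tX tY -> -> => /le_trans; apply.
have -> : \sum_j 0 * complex.Re (((invmx S) ^t* *m (Y - X) *m invmx S) j j) = 0 :> R.
  by rewrite big1 // => j _; rewrite mul0r.
rewrite addr0 -addrA lerD2l.
have h1 : m%:R * eta' <= eta / 2.
  have -> : m%:R * eta' = eta / 2 * (m%:R / (m%:R + 1)).
    by rewrite /eta'; field; rewrite gt_eqF.
  by rewrite ler_piMr ?divr_ge0 ?(ltW eta0) // ler_pdivrMr // mul1r lerDl.
have h2 : c * (\sum_i \sum_j nsq (((invmx S) ^t* *m (Y - X) *m invmx S) i j))
    <= D * eps ^+ 2.
  by rewrite /D -mulrA ler_wpM2l // (congr_frob_bound sX hp hH).
lra.
Qed.

(** Order intervals are bounded sets of matrices. *)
Lemma simdiag_entry_le A X S d hi : simdiag A X S d -> (forall j, d j <= hi) ->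
  entry_bounded X (hi * (2 * complex.Re (\tr A))).
Proof.
move=> [uS d0 EA EX] dhi i j.
have Ajj k : complex.Re (A k k) = \sum_l nsq (S l k) by rewrite EA adjmul_diag.
have A0 k : 0 <= complex.Re (A k k).
  by rewrite Ajj; apply: sumr_ge0 => l _; apply: nsq_ge0.
have Atr k : complex.Re (A k k) <= complex.Re (\tr A).
  rewrite /mxtrace Re_sum (bigD1 k) //= lerDl.
  by apply: sumr_ge0 => l _; apply: A0.
have hi0 : 0 <= hi by apply: le_trans (dhi i); exact: ltW.
apply: le_trans (_ : (hi * (complex.Re (A i i) + complex.Re (A j j)))%:C <= _); last first.
  rewrite lecR ler_wpM2l //; have := Atr i; have := Atr j; lra.
rewrite !Ajj -big_split mulr_sumr rmorph_sum EX mxE.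
apply: le_trans (ler_norm_sum _ _ _) _; apply: ler_sum => k _.
rewrite mul_mx_diag !mxE !normrM norm_conjC [ `|_%:C| ]ger0_norm; last first.
  by rewrite (lecR 0) ltW.
rewrite rmorphM mulrAC mulrC; apply: ler_pM.
- by rewrite (lecR 0) ltW.
- by rewrite mulr_ge0.
- by rewrite lecR.
rewrite rmorphD /= !nsqE -subr_ge0.
have -> : `|S k i| ^+ 2 + `|S k j| ^+ 2 - `|S k i| * `|S k j| =
  2^-1 * ((`|S k i| - `|S k j|) ^+ 2 + `|S k i| ^+ 2 + `|S k j| ^+ 2) by field.
have sq : 0 <= (`|S k i| - `|S k j|) ^+ 2.
  by rewrite real_exprn_even_ge0 // rpredB ?normr_real.
apply: mulr_ge0; first by rewrite invr_ge0 ler0n.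
by do 2 (apply: addr_ge0; last by rewrite exprn_ge0).
Qed.

Lemma matrix_cluster (X : nat -> 'M[C]_m) M :
  (forall k, entry_bounded (X k) M) ->
  exists L, forall eps, 0 < eps -> forall K, exists2 k, (K <= k)%N &
    entry_bounded (L - X k) eps.
Proof.
move=> hX.
pose u k (c : bool * ('I_m * 'I_m)) : R :=
  let z := X k c.2.1 c.2.2 in if c.1 then complex.Re z else complex.Im z.
have uM k c : `|u k c| <= M.
  by have [? ?] := Re_Im_le_norm (hX k c.2.1 c.2.2); rewrite /u; case: c.1.
have [l hl] := bounded_cluster uM.
exists (\matrix_(i, j) (l (true, (i, j)) +i* l (false, (i, j)))) => eps eps0 K.
have e20 : 0 < eps / 2 by rewrite divr_gt0.
have [k Kk hk] := hl _ e20 K; exists k => // i j.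
apply: le_trans (norm_le_ReIm _) _; rewrite lecR mxBE mxE.
have := hk (true, (i, j)); have := hk (false, (i, j)).
rewrite /u /= distrC => h1; rewrite distrC => h2.
move: h1 h2; case: (X k i j) => a b /=; lra.
Qed.

Lemma least_squaresE n (w : 'I_n -> R) (A : 'I_n -> 'M[C]_m) X :
  least_squares idfun w A X = \sum_i w i * trace_metric idfun X (A i) ^+ 2.
Proof. by []. Qed.

Lemma least_squares_ge0 n (w : 'I_n -> R) (A : 'I_n -> 'M[C]_m) X :
  (forall i, 0 < w i) -> 0 <= least_squares idfun w A X.
Proof.
by move=> w0; apply: sumr_ge0 => i _; rewrite mulr_ge0 ?sqr_ge0 // ltW.
Qed.

(** Coercivity: one summand [w_i (ln d_j)^2] is at most the whole
    sum, so every [ln d_j] is bounded on a sublevel set. *)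
Lemma sublevel_sandwiched n (w : 'I_n -> R) (A : 'I_n -> 'M[C]_m) s :
    (forall i, 0 < w i) -> (forall i, posdefmx Num.conj (A i)) -> 0 <= s ->
  exists lo hi, [/\ 0 < lo, lo <= hi & forall X, posdefmx Num.conj X ->
    least_squares idfun w A X <= s -> forall i, sandwiched lo hi (A i) X].
Proof.
move=> w0 pA s0; pose c := \sum_i (1 + s / w i).
have t0 i : 0 <= s / w i by rewrite divr_ge0 // ltW.
have c0 : 0 <= c by apply: sumr_ge0 => i _; rewrite addr_ge0.
exists (sequences.expR (- c)), (sequences.expR c); split; [exact: expR_gt0|by rewrite ler_expR; lra|].
move=> X pX hs i; have [S [d sX]] := simdiag_exists (pA i) pX.
have [_ d0 _ _] := sX.
have ln2 : \sum_j ln (d j) ^+ 2 <= s / w i.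
  rewrite ler_pdivlMr // mulrC; apply: le_trans hs.
  have : w i * trace_metric idfun X (A i) ^+ 2 <= least_squares idfun w A X.
    rewrite least_squaresE [X in _ <= X](bigD1 i) //= lerDl.
    by apply: sumr_ge0 => k _; rewrite mulr_ge0 ?sqr_ge0 // ltW.
  have := trace_metric_simdiag_sym sX.
  by generalize (trace_metric idfun X (A i)) => t ->.
have lnc j : `|ln (d j)| <= c.
  apply: le_trans (_ : 1 + s / w i <= _); last first.
    rewrite /c (bigD1 i) //= lerDl; apply: sumr_ge0 => k _; by rewrite addr_ge0.
  rewrite -ler_sqr ?nnegrE ?addr_ge0 // real_normK ?num_real //.
  have : ln (d j) ^+ 2 <= s / w i.
    apply: le_trans ln2; rewrite (bigD1 j) //= lerDl.
    by apply: sumr_ge0 => k _; apply: sqr_ge0.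
  have := t0 i; nra.
have dE j : d j = sequences.expR (ln (d j)) by rewrite lnK // posrE.
move=> x; split.
  by apply: simdiag_ge sX _ => j; rewrite dE ler_expR; have := lnc j; rewrite ler_norml => /andP[].
by apply: simdiag_le sX _ => j; rewrite dE ler_expR; have := lnc j; rewrite ler_norml => /andP[].
Qed.

Lemma herm_qform_real H x : H^t* = H ->
  (x^t* *m H *m x) 0 0 = (complex.Re ((x^t* *m H *m x) 0 0))%:C.
Proof.
move=> hH; rewrite RRe_real //; apply/CrealP.
have {2}<- : (x^t* *m H *m x)^t* = x^t* *m H *m x.
  by rewrite !adjM trmxCK hH mulmxA.
by rewrite !mxE.
Qed.

Lemma qform_entry_bounded x : exists2 D, 0 <= D & forall H eps,
  entry_bounded H eps -> `|(x^t* *m H *m x) 0 0| <= (D * eps)%:C.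
Proof.
have [a a0 ha] := entry_bounded_ex x.
exists (m%:R * (m%:R * a * a)); first by rewrite !mulr_ge0 ?ler0n.
move=> H eps hH.
have := entry_boundedM (entry_boundedM (entry_bounded_adj ha) hH) ha.
move=> /(_ 0 0); congr (_ <= _%:C); ring.
Qed.

Lemma herm_limit L :
  (forall eps, 0 < eps -> exists2 X, X^t* = X & entry_bounded (L - X) eps) ->
  L^t* = L.
Proof.
move=> h; apply/esym/eqP; rewrite -subr_eq0; apply/eqP/matrixP=> i j.
rewrite [RHS]mxE; apply/eqP; rewrite -normr_eq0 normc_def.
suff -> : Num.sqrt (complex.Re ((L - L ^t*) i j) ^+ 2 +
   complex.Im ((L - L ^t*) i j) ^+ 2) = 0 by [].
apply/eqP; rewrite eq_le sqrtr_ge0 andbT.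
apply: (@le_of_le_add_eps R _ _ 2) => // eps eps0.
have [X hX hb] := h _ eps0.
rewrite -lecR -normc_def add0r.
have -> : L - L^t* = (L - X) - (L - X)^t*.
  by rewrite adjB hX opprB addrA subrK.
rewrite mxBE (le_trans (ler_normB _ _)) //.
have -> : (2 * eps)%:C = eps%:C + eps%:C by rewrite -rmorphD -mulr2n mulr_natl.
by apply: lerD; [exact: hb|exact: (entry_bounded_adj hb)].
Qed.

Lemma sandwiched_limit lo hi A L : A^t* = A ->
  (forall eps, 0 < eps -> exists X, [/\ X^t* = X, sandwiched lo hi A X &
     entry_bounded (L - X) eps]) ->
  sandwiched lo hi A L.
Proof.
move=> hA h.
have hL : L^t* = L.
  by apply: herm_limit => eps eps0; have [X [hX _ hb]] := h _ eps0; exists X.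
move=> x; have [D D0 hD] := qform_entry_bounded x.
rewrite (herm_qform_real x hL) (herm_qform_real x hA) -!rmorphM !lecR.
have close eps : 0 < eps -> exists X, [/\ X^t* = X, sandwiched lo hi A X &
   `|complex.Re ((x^t* *m L *m x) 0 0) - complex.Re ((x^t* *m X *m x) 0 0)|
      <= D * eps].
  move=> eps0; have [X [hX sX hb]] := h _ eps0; exists X; split => //.
  have [+ _] := Re_Im_le_norm (hD _ _ hb).
  by rewrite mulmxBr mulmxBl mxBE; case: (_ 0 0) => a b; case: (_ 0 0).
have sandR X : X^t* = X -> sandwiched lo hi A X ->
    lo * complex.Re ((x^t* *m A *m x) 0 0) <= complex.Re ((x^t* *m X *m x) 0 0) /\
    complex.Re ((x^t* *m X *m x) 0 0) <= hi * complex.Re ((x^t* *m A *m x) 0 0).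
  move=> hX /(_ x).
  by rewrite (herm_qform_real x hX) (herm_qform_real x hA) -!rmorphM !lecR.
move: close sandR; generalize ((x^t* *m L *m x) 0 0) ((x^t* *m A *m x) 0 0) => l a.
move=> close sandR; split; apply: (le_of_le_add_eps D0) => eps eps0;
  have [X [hX sX]] := close _ eps0; have [s1 s2] := sandR X hX sX;
  move: s1 s2; rewrite ler_norml;
  generalize (complex.Re ((x^t* *m X *m x) 0 0)) => q s1 s2 /andP[s3 s4]; lra.
Qed.

(** A minimizing sequence stays in an order interval, which is bounded
    and closed, and the objective is uniformly continuous there. *)
Lemma minimizer_exists n (w : 'I_n -> R) (A : 'I_n -> 'M[C]_m) (i0 : 'I_n) :
    (forall i, 0 < w i) -> \sum_i w i = 1 ->
    (forall i, posdefmx Num.conj (A i)) ->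
  exists X, minimizer w A X.
Proof.
move=> w0 w1 pA; pose F := least_squares idfun w A.
pose E : set R := fun r => exists2 X, posdefmx Num.conj X & r = F X.
have infE : has_inf E.
  split; first by exists (F (A i0)), (A i0).
  by exists 0 => _ [X _ ->]; apply: least_squares_ge0.
pose g := inf E.
have gle X : posdefmx Num.conj X -> g <= F X.
  by move=> pX; apply: ge_inf; [case: infE|exists X].
have g0 : 0 <= g.
  by apply: lb_le_inf; [case: infE|move=> _ [X _ ->]; apply: least_squares_ge0].
have /choice [X hX] (k : nat) : exists X, posdefmx Num.conj X /\ F X < g + k.+1%:R^-1.
  have [|_ [X pX ->] ?] := inf_adherent (_ : 0 < k.+1%:R^-1) infE.
    by rewrite invr_gt0 ltr0n.
  by exists X.
have pX k : posdefmx Num.conj (X k) by case: (hX k).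
have g1 : 0 <= g + 1 by rewrite addr_ge0.
have [lo [hi [lo0 lohi sand]]] := sublevel_sandwiched w0 pA g1.
have sX k i : sandwiched lo hi (A i) (X k).
  apply: sand => //; have [_ /ltW h] := hX k; apply: le_trans h _.
  by rewrite lerD2l invf_le1 ?ler1n // ltr0n.
have bX k : entry_bounded (X k) (hi * (2 * complex.Re (\tr (A i0)))).
  have [S [d sXk]] := simdiag_exists (pA i0) (pX k).
  apply: (simdiag_entry_le sXk) => j.
  by have /andP[] := sandwiched_eig sXk (sX k i0) j.
have [L hL] := matrix_cluster bX.
have sL i : sandwiched lo hi (A i) L.
  apply: sandwiched_limit; first exact: posdef_herm.
  move=> eps eps0; have [k _ hk] := hL _ eps0 0.
  by exists (X k); split; [exact: posdef_herm| |].
have pL : posdefmx Num.conj L.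
  split.
    apply/hermP/herm_limit => eps eps0; have [k _ hk] := hL _ eps0 0.
    by exists (X k) => //; exact: posdef_herm.
  move=> x x0; have [h _] := sL i0 x; apply: lt_le_trans h.
  by rewrite mulr_gt0 ?(ltcR 0) //; case: (pA i0) => _; apply.
suff FLg : F L <= g.
  by exists L; split=> [|Y pY]; [exact: pL|exact: (le_trans FLg (gle Y pY))].
apply: (@le_of_le_add_eps R _ _ 2); first exact: ler0n.
move=> eta eta0.
have /choice [ep hep] i : exists eps, 0 < eps /\ forall k,
    entry_bounded (L - X k) eps ->
    trace_metric idfun L (A i) ^+ 2 <= trace_metric idfun (X k) (A i) ^+ 2 + eta.
  have [eps eps0 h] := trace_metric_uniform (pA i) lo0 lohi eta0.
  exists eps; split=> [//|k hk].
  exact: (h _ _ (pX k) pL (sX k i) (sL i) hk).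
pose epm := \big[Num.min/1]_i ep i.
have epm0 : 0 < epm.
  by rewrite /epm; elim/big_ind: _ => // [x y x0 y0|i _]; [rewrite lt_min x0|case: (hep i)].
have epml i : epm <= ep i by rewrite /epm (bigD1 i) //= ge_min lexx.
have [K hK] : exists K, K.+1%:R^-1 < eta.
  by have [K] := ltr_add_invr eta0; rewrite add0r; exists K.
have [k Kk hk] := hL _ epm0 K.
have Fk : F (X k) <= g + eta.
  have [_ /ltW h] := hX k; apply: le_trans h _; rewrite lerD2l (le_trans _ (ltW hK)) //.
  by rewrite lef_pV2 ?posrE ?ltr0n // ler_nat.
have FL : F L <= F (X k) + eta.
  rewrite -[eta in X in _ <= X]mul1r -w1 mulr_suml -big_split /=.
  apply: ler_sum => i _; rewrite -mulrDr ler_wpM2l ?(ltW (w0 i)) //.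
  have [_ h] := hep i; apply: h => a b; apply: le_trans (hk a b) _.
  by rewrite lecR.
move: Fk FL; generalize (F L) (F (X k)) => f1 f2; lra.
Qed.

(** Monotonicity applied both ways with equal data. *)
Lemma minimizer_unique n (w : 'I_n -> R) (A : 'I_n -> 'M[C]_m) X Y :
    (forall i, 0 < w i) -> \sum_i w i = 1 ->
    (forall i, posdefmx Num.conj (A i)) ->
  minimizer w A X -> minimizer w A Y -> X = Y.
Proof.
move=> w0 w1 pA mX mY.
have AA i : loewner_le Num.conj (A i) (A i) by apply/loewner_refl/posdef_herm.
apply: loewner_antisym; [by case: mX|by case: mY| |].
- exact: (minimizer_mono w0 w1 pA pA AA mY mX).
- exact: (minimizer_mono w0 w1 pA pA AA mX mY).
Qed.

(** * Transfer to real symmetric matrices *)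

Lemma simdiag_conj A X S d : simdiag A X S d ->
  simdiag (map_mx conjC A) (map_mx conjC X) (map_mx conjC S) d.
Proof.
move=> [uS d0 -> ->].
have E : map_mx conjC (S^t*) = (map_mx conjC S)^t* by rewrite map_trmx.
have D : map_mx conjC (dmx d) = dmx d.
  by rewrite -[RHS]adj_dmx /dmx tr_diag_mx.
by split; [rewrite map_unitmx| |rewrite map_mxM E|rewrite !map_mxM E D].
Qed.

Lemma posdef_conj A : posdefmx Num.conj A -> posdefmx Num.conj (map_mx conjC A).
Proof.
move=> pA; have [S [d sd]] := simdiag_exists pA pA.
exact: (simdiag_posdef (simdiag_conj sd)).
Qed.

Lemma trace_metric_conj X A : posdefmx Num.conj A -> posdefmx Num.conj X ->
  trace_metric idfun (map_mx conjC X) (map_mx conjC A) ^+ 2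
    = trace_metric idfun X A ^+ 2.
Proof.
move=> pA pX; have [S [d sd]] := simdiag_exists pA pX.
apply: etrans (trace_metric_simdiag_sym (simdiag_conj sd)) _.
exact/esym/(trace_metric_simdiag_sym sd).
Qed.

(** Conjugation preserves the objective when the [A i] are real, so the
    conjugate of the minimizer is the minimizer. *)
Lemma minimizer_real n (w : 'I_n -> R) (A : 'I_n -> 'M[C]_m) X :
    (forall i, 0 < w i) -> \sum_i w i = 1 ->
    (forall i, posdefmx Num.conj (A i)) ->
    (forall i, map_mx conjC (A i) = A i) ->
  minimizer w A X -> map_mx conjC X = X.
Proof.
move=> w0 w1 pA rA mX; apply: (minimizer_unique w0 w1 pA _ mX).
have [pX minX] := mX; split=> [|Y pY]; first exact: posdef_conj.
suff -> : least_squares idfun w A (map_mx conjC X) = least_squares idfun w A X.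
  exact: minX.
apply: eq_bigr => i _; have h := trace_metric_conj (pA i) pX.
by rewrite (rA i) in h; exact: (congr1 (fun t => w i * t) h).
Qed.

Local Notation rc := (map_mx (real_complex R)).

Lemma conj_rc p q (M : 'M[R]_(p, q)) : map_mx conjC (rc M) = rc M.
Proof. by apply/matrixP=> i j; rewrite !mxE conjC_real. Qed.

Lemma rc_of_conj_fixed X : map_mx conjC X = X -> exists M : 'M[R]_m, X = rc M.
Proof.
move=> h; exists (map_mx (@complex.Re R) X); apply/matrixP=> i j.
rewrite !mxE RRe_real //; apply/CrealP.
by rewrite -[in RHS]h mxE.
Qed.

Lemma rc_adj p q (M : 'M[R]_(p, q)) : (rc M)^t* = rc M^T.
Proof. by apply/matrixP=> i j; rewrite !mxE conjC_real. Qed.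

Lemma rc_herm (A : 'M[R]_m) :
  (A \is hermitianmx m false idfun) = (rc A \is hermsymmx).
Proof.
rewrite !is_hermitianmxE !expr0 !scale1r rc_adj.
rewrite (inj_eq (@map_mx_inj _ _ (real_complex R) _ _)).
by rewrite [in LHS]map_mx_id.
Qed.

Lemma rc_qform (A : 'M[R]_m) (x : 'cV[R]_m) :
  ((rc x)^t* *m rc A *m rc x) 0 0 = ((x ^t idfun *m A *m x) 0 0)%:C.
Proof.
rewrite rc_adj -!map_mxM mxE; congr (_ 0 0)%:C; congr (_ *m _ *m _).
by rewrite map_mx_id.
Qed.

(** The cross terms between real and imaginary part cancel because [A]
    is symmetric; positivity on real vectors thus passes to complex ones. *)
Lemma rc_qform_split (A : 'M[R]_m) x (a := map_mx (@complex.Re R) x)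
    (b := map_mx (@complex.Im R) x) : A \is hermitianmx m false idfun ->
  (x^t* *m rc A *m x) 0 0 =
    ((a ^t idfun *m A *m a) 0 0 + (b ^t idfun *m A *m b) 0 0)%:C.
Proof.
rewrite rc_herm => /hermP hA; rewrite (herm_qform_real x hA); congr _%:C.
have splitE (M : 'M[R]_m) (y : 'cV[R]_m) : (y ^t idfun *m M *m y) 0 0
    = \sum_j \sum_i y i 0 * M i j * y j 0.
  rewrite mxE; apply: eq_bigr => j _; rewrite mxE mulr_suml.
  by apply: eq_bigr => i _; rewrite !mxE.
rewrite !splitE mxE Re_sum -big_split; apply: eq_bigr => j _ /=.
rewrite mxE mulr_suml Re_sum -big_split; apply: eq_bigr => i _ /=.
rewrite !mxE; by case: (x i 0) (x j 0) => [x1 x2] [y1 y2] /=; ring.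
Qed.

Lemma rc_qform_gt0 (A : 'M[R]_m) x : posdefmx idfun A -> x != 0 ->
  0 < (x^t* *m rc A *m x) 0 0.
Proof.
move=> [hA pA] x0; rewrite rc_qform_split // (ltcR 0).
have ge0 (y : 'cV[R]_m) : 0 <= (y ^t idfun *m A *m y) 0 0.
  by have [->|/pA/ltW //] := eqVneq y 0; rewrite mulmx0 mxE.
have [Re0|/pA Re_gt0] := eqVneq (map_mx (@complex.Re R) x) 0; last first.
  by rewrite ltr_pwDl.
have [Im0|/pA Im_gt0] := eqVneq (map_mx (@complex.Im R) x) 0; last first.
  by rewrite ltr_wpDl.
case/eqP: x0; apply/matrixP=> i j.
move/matrixP/(_ i j): Re0; move/matrixP/(_ i j): Im0; rewrite !mxE.
by case: (x i j) => a b /= -> ->.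
Qed.

Lemma rc_posdef (A : 'M[R]_m) : posdefmx idfun A <-> posdefmx Num.conj (rc A).
Proof.
split=> [pA|[hA pA]].
  split; first by rewrite -rc_herm; case: pA.
  by move=> x x0; apply: rc_qform_gt0.
split; first by rewrite rc_herm.
move=> x x0; rewrite -(ltcR 0) -rc_qform; apply: pA.
by rewrite map_mx_eq0.
Qed.

Lemma rc_loewner (A B : 'M[R]_m) :
  loewner_le idfun B A <-> loewner_le Num.conj (rc B) (rc A).
Proof.
rewrite /loewner_le -map_mxB; split=> [[hA pA]|[hA pA]].
  split; first by rewrite -rc_herm.
  by move=> x; rewrite rc_qform_split // (lecR 0) addr_ge0.
split; first by rewrite rc_herm.
by move=> x; rewrite -(lecR 0) -rc_qform.
Qed.

Lemma rc_least_squares n (w : 'I_n -> R) (A : 'I_n -> 'M[R]_m) (X : 'M[R]_m) :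
  least_squares (real_complex R) w A X
    = least_squares idfun w (fun i => rc (A i)) (rc X).
Proof.
apply: eq_bigr => i _.
have h : rc (invmx X *m A i) = map_mx idfun (invmx (rc X) *m rc (A i)).
  by rewrite [RHS]map_mx_id // map_mxM map_invmx.
pose t (M : 'M[C]_m) : R := Num.sqrt (\sum_(l <- eigenvalues M) ln (complex.Re l) ^+ 2).
have h2 : trace_metric (real_complex R) X (A i)
    = trace_metric idfun (rc X) (rc (A i)) := congr1 t h.
exact: (congr1 (fun u => w i * u ^+ 2) h2).
Qed.

Lemma least_squares_mean_minimizer n (w : 'I_n -> R) (A : 'I_n -> 'M[C]_m)
    (i0 : 'I_n) : (forall i, 0 < w i) -> \sum_i w i = 1 ->
    (forall i, posdefmx Num.conj (A i)) ->
  minimizer w A (least_squares_mean Num.conj idfun w A).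
Proof.
move=> w0 w1 pA; have [X mX] := minimizer_exists i0 w0 w1 pA.
exact: (xgetI _ (mX : [set X | _]%classic X)).
Qed.

Lemma least_squares_mean_real_minimizer n (w : 'I_n -> R)
    (A : 'I_n -> 'M[R]_m) (i0 : 'I_n) : (forall i, 0 < w i) -> \sum_i w i = 1 ->
    (forall i, posdefmx idfun (A i)) ->
  minimizer w (fun i => rc (A i))
    (rc (least_squares_mean idfun (real_complex R) w A)).
Proof.
move=> w0 w1 pA.
have pA' i : posdefmx Num.conj (rc (A i)) by apply/rc_posdef.
have [Z mZ] := minimizer_exists i0 w0 w1 pA'.
have [M EZ] := rc_of_conj_fixed (minimizer_real w0 w1 pA' (fun i => conj_rc (A i)) mZ).
have [pZ minZ] := mZ; rewrite EZ in pZ minZ.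
pose P : set 'M[R]_m := [set X : 'M[R]_m |
  posdefmx idfun X /\ forall Y : 'M[R]_m, posdefmx idfun Y ->
  least_squares (real_complex R) w A X <= least_squares (real_complex R) w A Y]%classic.
have PM : P M.
  split; first exact/rc_posdef.
  move=> Y pY; rewrite !rc_least_squares; apply: minZ; exact/rc_posdef.
have [pX minX] := xgetI 1%:M PM.
rewrite -/(least_squares_mean idfun (real_complex R) w A) in pX minX.
split; first exact/rc_posdef.
move=> Y pY; apply: le_trans (minZ Y pY); rewrite -!rc_least_squares.
by apply: minX; apply/rc_posdef.
Qed.

End Size.
End Hermitian.

Theorem corollary6p4 (R : realType) (m n : nat) (hn : (2 <= n)%N)
    (w : 'I_n -> R) (hw : is_weight w) :
  (* real symmetric matrices *)
  (forall A B : 'I_n -> 'M[R]_m,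
    (forall i, posdefmx idfun (A i)) -> (forall i, posdefmx idfun (B i)) ->
    (forall i, loewner_le idfun (B i) (A i)) ->
    loewner_le idfun
      (least_squares_mean idfun (real_complex R) w B)
      (least_squares_mean idfun (real_complex R) w A)) /\
  (* complex Hermitian matrices *)
  (forall A B : 'I_n -> 'M[R[i]]_m,
    (forall i, posdefmx Num.conj (A i)) ->
    (forall i, posdefmx Num.conj (B i)) ->
    (forall i, loewner_le Num.conj (B i) (A i)) ->
    loewner_le Num.conj
      (least_squares_mean Num.conj idfun w B)
      (least_squares_mean Num.conj idfun w A)).
Proof.
have [w0 w1] := hw; have i0 : 'I_n := Ordinal (ltnW hn).
split=> A B pA pB leBA; last first.
  apply: (minimizer_mono w0 w1 pA pB leBA);
    exact: least_squares_mean_minimizer.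
have rcP (X : 'I_n -> 'M[R]_m) : (forall i, posdefmx idfun (X i)) ->
  forall i, posdefmx Num.conj (map_mx (real_complex R) (X i)).
  by move=> pX i; apply/rc_posdef.
apply/rc_loewner.
apply: (minimizer_mono w0 w1 (rcP A pA) (rcP B pB) (fun i => (rc_loewner _ _).1 (leBA i)));
  exact: least_squares_mean_real_minimizer.
Qed.
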